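(* Let $\alpha\in F$. The trace $T$-ideal $\mathrm{Id}^{tr}\big(C_2^{t_{\alpha,1}}\big)$ is generated, as a $T^{tr}$-ideal, by the polynomials \begin{align*} f_1&=[x_1,x_2],\\ h_4&=\mathrm{Tr}(x_1)\mathrm{Tr}(x_2)x_3-\mathrm{Tr}(x_2)\mathrm{Tr}(x_3)x_1+\mathrm{Tr}(x_1x_2)\mathrm{Tr}(x_3)-\mathrm{Tr}(x_2x_3)\mathrm{Tr}(x_1)-\alpha\mathrm{Tr}(x_1x_2)x_3+\alpha\mathrm{Tr}(x_2x_3)x_1,\\ h_5&=-\mathrm{Tr}(x_1x_2)x_3-\mathrm{Tr}(x_1x_3)x_2-\mathrm{Tr}(x_2x_3)x_1+\mathrm{Tr}(x_1x_2x_3)+\mathrm{Tr}(x_1)x_2x_3+\mathrm{Tr}(x_2)x_1x_3+\mathrm{Tr}(x_3)x_1x_2-\alpha x_1x_2x_3. \end{align*} Moreover, for every $n\ge1$, $c_n^{tr}\big(C_2^{t_{\alpha,1}}\big)=2^{n+1}-n-1$.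
   Context: $F$ is a field of characteristic zero; all algebras are associative, unitary, over $F$. An algebra with trace is an algebra $A$ with a linear map $\mathrm{tr}\colon A\to F$ such that $\mathrm{tr}(ab)=\mathrm{tr}(ba)$ for all $a,b\in A$; $F$ is identified with $F\cdot 1_A\subseteq A$. Let $X=\{x_1,x_2,\dots\}$ and let $\mathcal M$ be the set of (nonempty) monomials in the noncommuting variables of $X$. The free algebra with trace is $F\langle X,\mathrm{Tr}\rangle\cong F\langle X\rangle\otimes F[\mathrm{Tr}(M)\mid M\in\mathcal M]$, where the $\mathrm{Tr}(M)$ are central commuting variables subject to $\mathrm{Tr}(MN)=\mathrm{Tr}(NM)$ and $\mathrm{Tr}(\mathrm{Tr}(M)N)=\mathrm{Tr}(M)\mathrm{Tr}(N)$. Its elements are called trace polynomials; the symbol $\mathrm{Tr}(1)$ does not occur. A trace polynomial is pure if all its variables appear inside traces. A trace polynomial $f(x_1,\dots,x_n,\mathrm{Tr})$ is a trace identity of $A$ if it vanishes whenever the $x_i$ are replaced by arbitrary elements of $A$ and $\mathrm{Tr}$ by $\mathrm{tr}$. $\mathrm{Id}^{tr}(A)$ is the set of all trace identities of $A$. A $T^{tr}$-ideal (trace $T$-ideal) is an ideal of $F\langle X,\mathrm{Tr}\rangle$ invariant under all endomorphisms (substitutions of the variables by linear combinations, with coefficients in $F[\mathrm{Tr}(M)\mid M\in\mathcal M]$, of nonempty monomials, compatibly with $\mathrm{Tr}$) and closed under taking traces ($f\mapsto \mathrm{Tr}(fM)$ for $M\in\mathcal M$, and $f\mapsto\mathrm{Tr}(f)$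 when $f$ has no pure trace term). The $T^{tr}$-ideal generated by a set is the smallest one containing it. $[x_1,x_2]=x_1x_2-x_2x_1$. $MT_n$ is the space of multilinear trace polynomials in $x_1,\dots,x_n$, spanned by the elements $\mathrm{Tr}(x_{i_1}\cdots x_{i_a})\cdots\mathrm{Tr}(x_{j_1}\cdots x_{j_b})x_{l_1}\cdots x_{l_c}$ in which each of $x_1,\dots,x_n$ occurs exactly once. The $n$-th trace codimension is $c_n^{tr}(A)=\dim_F MT_n/(MT_n\cap\mathrm{Id}^{tr}(A))$. $C_2=\left\{\begin{pmatrix}a&b\\0&a\end{pmatrix}\mid a,b\in F\right\}$, and $C_2^{t_{\alpha,\beta}}$ is $C_2$ with the trace $t_{\alpha,\beta}\begin{pmatrix}a&b\\0&a\end{pmatrix}=\alpha a+\beta b$. *)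

(* Defs.v *)
From HB Require Import structures.
From mathcomp Require Import all_boot all_order all_algebra.
From mathcomp Require Import generic_quotient.
From mathcomp Require Import finmap monalg.

Set Implicit Arguments.
Unset Strict Implicit.
Unset Printing Implicit Defensive.

Import GRing.Theory.
Local Open Scope ring_scope.
Local Open Scope quotient_scope.

(* The variable x_(i+1) is represented by the natural number i.               *)

Definition nword := {w : seq nat | w != [::]}.

Definition rotations (w : seq nat) := [seq rot i w | i <- iota 0 (size w)].

(* v = NM and u = MN for some words M, N.                                     *)
Definition cyc_rel (u v : nword) : bool := val v \in rotations (val u).

Lemma rotationsP (u v : nword) :
  reflect (exists i, val v = rot i (val u)) (cyc_rel u v).
Proof.
apply: (iffP mapP) => [[i _ ->]|[i ->]]; first by exists i.
have u_gt0: (0 < size (val u))%N by rewrite lt0n size_eq0 (valP u).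
have [lt_i|le_i] := ltnP i (size (val u)).
  by exists i; rewrite // mem_iota.
by exists 0; rewrite ?mem_iota // rot_oversize // rot0.
Qed.

Lemma cyc_rel_refl : reflexive cyc_rel.
Proof. by move=> u; apply/rotationsP; exists 0; rewrite rot0. Qed.

Lemma cyc_rel_sym : symmetric cyc_rel.
Proof.
suff sub u v : cyc_rel u v -> cyc_rel v u by move=> u v; apply/idP/idP => /sub.
case/rotationsP=> i def_v; apply/rotationsP; exists (size (val v) - i)%N.
by rewrite -/(rotr i (val v)) def_v rotK.
Qed.

Lemma cyc_rel_trans : transitive cyc_rel.
Proof.
move=> v u w /rotationsP[i def_v] /rotationsP[j def_w]; apply/rotationsP.
by rewrite def_w def_v rot_rot_add; eexists.
Qed.

Canonical cyc_equiv := EquivRel cyc_rel cyc_rel_refl cyc_rel_sym cyc_rel_trans.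

Definition cycword := {eq_quot cyc_equiv}.
HB.instance Definition _ := Choice.on cycword.
HB.instance Definition _ := EqQuotient.on cycword.

(* {malg R[K]} with a locked product: unlocked, it is unfolded down to the    *)
(* convolution of supports whenever two products fail to unify.               *)
Definition mon_alg (K : monomType) (R : nzRingType) : Type := {malg R[K]}.

HB.instance Definition _ (K : monomType) (R : nzRingType) :=
  GRing.Zmodule.on (mon_alg K R).

HB.lock Definition mon_alg_mul (K : monomType) (R : nzRingType)
  (f g : mon_alg K R) : mon_alg K R := (f : {malg R[K]}) * (g : {malg R[K]}).

Section MonoidAlgebra.
Variables (K : monomType) (R : nzRingType).
Local Notation A := (mon_alg K R).
Local Notation "1" := (1 : {malg R[K]}) : ring_scope.

Lemma mon_alg_mulA : associative (@mon_alg_mul K R).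
Proof. by move=> f g h; rewrite unlock; exact: mulrA. Qed.

Lemma mon_alg_mul1r : left_id (1 : A) (@mon_alg_mul K R).
Proof. by move=> f; rewrite unlock; exact: mul1r. Qed.

Lemma mon_alg_mulr1 : right_id (1 : A) (@mon_alg_mul K R).
Proof. by move=> f; rewrite unlock; exact: mulr1. Qed.

Lemma mon_alg_mulDl : left_distributive (@mon_alg_mul K R) +%R.
Proof. by move=> f g h; rewrite unlock; exact: mulrDl. Qed.

Lemma mon_alg_mulDr : right_distributive (@mon_alg_mul K R) +%R.
Proof. by move=> f g h; rewrite unlock; exact: mulrDr. Qed.

Lemma mon_alg_1_neq0 : (1 : A) != 0.
Proof. exact: oner_neq0. Qed.

HB.instance Definition _ := GRing.Zmodule_isNzRing.Build A
  mon_alg_mulA mon_alg_mul1r mon_alg_mulr1 mon_alg_mulDl mon_alg_mulDr mon_alg_1_neq0.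

End MonoidAlgebra.

Lemma mon_alg_mulC (K : conomType) (R : comNzRingType) :
  commutative (@mon_alg_mul K R).
Proof. by move=> f g; rewrite unlock; exact: mulrC. Qed.

HB.instance Definition _ (K : conomType) (R : comNzRingType) :=
  GRing.PzRing_hasCommutativeMul.Build (mon_alg K R) (@mon_alg_mulC K R).

Lemma mon_algME (K : monomType) (R : nzRingType) (f g : mon_alg K R) :
  f * g = (f : {malg R[K]}) * (g : {malg R[K]}).
Proof. by rewrite {1}/GRing.mul /= unlock. Qed.

HB.lock Definition mon_algC (K : monomType) (R : nzRingType) (c : R) : mon_alg K R :=
  (c%:MP : {malg R[K]}).
Arguments mon_algC K {R} c.

Lemma mon_algCE (K : monomType) (R : nzRingType) (c : R) :
  mon_algC K c = (c%:MP : {malg R[K]}).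
Proof. by rewrite unlock. Qed.

Lemma mon_algC_is_zmod_morphism (K : monomType) (R : nzRingType) :
  zmod_morphism (@mon_algC K R).
Proof. by move=> c d; rewrite !mon_algCE; exact: raddfB. Qed.

Lemma mon_algC_is_monoid_morphism (K : monomType) (R : nzRingType) :
  monoid_morphism (@mon_algC K R).
Proof. by split=> [|c d]; rewrite !mon_algCE // mon_algME; exact: mpolyCM. Qed.

HB.instance Definition _ (K : monomType) (R : nzRingType) :=
  GRing.isZmodMorphism.Build R (mon_alg K R) (@mon_algC K R)
    (@mon_algC_is_zmod_morphism K R).
HB.instance Definition _ (K : monomType) (R : nzRingType) :=
  GRing.isMonoidMorphism.Build R (mon_alg K R) (@mon_algC K R)
    (@mon_algC_is_monoid_morphism K R).

Lemma mon_algC_comm (K : monomType) (R : comNzRingType) (c : R)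
  (f : mon_alg K R) : mon_algC K c * f = f * mon_algC K c.
Proof.
rewrite !mon_algME !mon_algCE mul_malgC malgM_def fgmulgU malgZ_def.
by apply: eq_bigr => k _; rewrite mulrC mulm1.
Qed.

HB.lock Definition mon_algX (K : monomType) (R : nzRingType) (k : K) :
  mon_alg K R := (<< k >> : {malg R[K]}).
Arguments mon_algX {K R} k.

Lemma mon_algXE (K : monomType) (R : nzRingType) (k : K) :
  mon_algX k = (<< k >> : {malg R[K]}).
Proof. by rewrite unlock. Qed.

(* F[Tr(M) | M in MM]: the polynomial variables are the symbols Tr(M), and    *)
(* indexing them by cyclic words imposes Tr(MN) = Tr(NM).                     *)
Definition ptrace (F : fieldType) := mon_alg {cmonom cycword} F.
HB.instance Definition _ (F : fieldType) := GRing.ComNzRing.on (ptrace F).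

(* F<X,Tr> = F<X> (x) F[Tr(M) | M in MM], as the free associative algebra on  *)
(* X with coefficients in F[Tr(M) | M in MM].                                 *)
Definition tpoly (F : fieldType) := mon_alg {fmonom nat} (ptrace F).
HB.instance Definition _ (F : fieldType) := GRing.NzRing.on (tpoly F).

Definition pt_emb (F : fieldType) (p : ptrace F) : tpoly F := mon_algC _ p.
HB.instance Definition _ (F : fieldType) :=
  GRing.RMorphism.copy (@pt_emb F) (mon_algC {fmonom nat}).

Section FreeTraceAlgebra.
Variable F : fieldType.
Implicit Types (p : ptrace F) (f g : tpoly F).

(* The library makes the malg type underlying tpoly F a module over ptrace F; *)
(* this is the F-algebra structure.                                           *)
Definition tscale (c : F) f : tpoly F := pt_emb (mon_algC _ c) * f.

Lemma tscaleA c d f : tscale c (tscale d f) = tscale (c * d) f.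
Proof. by rewrite /tscale mulrA -!rmorphM. Qed.

Lemma tscale1r : left_id 1 tscale.
Proof. by move=> f; rewrite /tscale !rmorph1 mul1r. Qed.

Lemma tscaleDr : right_distributive tscale +%R.
Proof. by move=> c f g; rewrite /tscale mulrDr. Qed.

Lemma tscaleDl f : {morph tscale^~ f : c d / c + d}.
Proof. by move=> c d; rewrite /tscale -mulrDl -!rmorphD. Qed.

Lemma tscaleAl c f g : tscale c (f * g) = tscale c f * g.
Proof. by rewrite /tscale mulrA. Qed.

HB.instance Definition _ := GRing.Zmodule_isLmodule.Build F (tpoly F)
  tscaleA tscale1r tscaleDr tscaleDl.
HB.instance Definition _ := GRing.Lmodule_isLalgebra.Build F (tpoly F) tscaleAl.

Lemma tscaleAr c f g : c *: (f * g) = f * (c *: g).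
Proof. by rewrite /GRing.scale /= /tscale !mulrA /pt_emb mon_algC_comm. Qed.

HB.instance Definition _ := GRing.Lalgebra_isAlgebra.Build F (tpoly F) tscaleAr.

End FreeTraceAlgebra.

Section TraceOperations.
Variable F : fieldType.
Implicit Types (p : ptrace F) (f g : tpoly F).

Definition tvar (i : nat) : tpoly F := mon_algX (fmu i).
Definition tword (w : seq nat) : tpoly F := \prod_(i <- w) tvar i.

(* The value 0 on the empty word is a default: Tr(1) does not exist.          *)
Definition tr_word (w : seq nat) : ptrace F :=
  if insub w is Some u then mon_algX (ucm (\pi_cycword u)) else 0.

(* Linear over ptrace F, which encodes Tr(Tr(M)N) = Tr(M)Tr(N).               *)
Definition ptr f : ptrace F :=
  mmap idfun (fun w : {fmonom nat} => tr_word w) (f : {malg (ptrace F)[_]}).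

Definition Tr f : tpoly F := pt_emb (ptr f).

Definition no_pure_term f : Prop :=
  (f : {malg (ptrace F)[{fmonom nat}]})@_mone = 0.

(* The ring morphism on ptrace F that is phi on F and sends the variable      *)
(* indexed by a cyclic word c to h c.                                         *)
Definition pt_map (S : comNzRingType) (phi : F -> S) (h : cycword -> S) p : S :=
  mmap phi (fun m : {cmonom cycword} => \prod_(c <- finsupp m) h c ^+ m c)
    (p : {malg F[{cmonom cycword}]}).

(* The endomorphism x_i |-> s i of F<X,Tr> compatible with Tr; it is only     *)
(* meaningful when no s i has a pure term.                                    *)
Definition tsubst (s : nat -> tpoly F) f : tpoly F :=
  mmap (fun p => pt_emb (pt_map (mon_algC _)
                   (fun c => ptr (\prod_(i <- val (repr c)) s i)) p))
       (fun w : {fmonom nat} => \prod_(i <- w) s i)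
       (f : {malg (ptrace F)[_]}).

(* Closure under opposite follows from Ttr_idealMl with -1.                   *)
Record Ttr_ideal (I : tpoly F -> Prop) : Prop := {
  Ttr_ideal0 : I 0;
  Ttr_idealD : forall f g, I f -> I g -> I (f + g);
  Ttr_idealMl : forall f g, I g -> I (f * g);
  Ttr_idealMr : forall f g, I f -> I (f * g);
  Ttr_ideal_subst : forall s f,
    (forall i, no_pure_term (s i)) -> I f -> I (tsubst s f);
  Ttr_ideal_TrM : forall f w, w != [::] -> I f -> I (Tr (f * tword w));
  Ttr_ideal_Tr : forall f, no_pure_term f -> I f -> I (Tr f)
}.

Definition Ttr_generated (S : tpoly F -> Prop) f : Prop :=
  forall I, Ttr_ideal I -> (forall g, S g -> I g) -> I f.

(* ts lists the arguments of the traces and w is the part outside the traces. *)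
Definition multilinear_monomial (n : nat) (ts : seq (seq nat)) (w : seq nat) :=
  all (fun v => v != [::]) ts && perm_eq (flatten ts ++ w) (iota 0 n).

Definition MT (n : nat) f : Prop :=
  exists l : seq (F * (seq (seq nat) * seq nat)),
    all (fun t => multilinear_monomial n t.2.1 t.2.2) l /\
    f = \sum_(t <- l) t.1 *: ((\prod_(v <- t.2.1) Tr (tword v)) * tword t.2.2).

End TraceOperations.

Record trace (F : fieldType) (A : algType F) := Trace {
  trace_fun :> {scalar A};
  traceC : forall a b : A, trace_fun (a * b) = trace_fun (b * a)
}.

Section TraceIdentities.
Variables (F : fieldType) (A : algType F) (tr : trace A).

Definition teval (a : nat -> A) (f : tpoly F) : A :=
  mmap (fun p => (pt_map idfun
                   (fun c => tr (\prod_(i <- val (repr c)) a i)) p)%:A)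
       (fun w : {fmonom nat} => \prod_(i <- w) a i)
       (f : {malg (ptrace F)[_]}).

Definition trace_identity (f : tpoly F) : Prop :=
  forall a : nat -> A, teval a f = 0.

End TraceIdentities.

(* dim U / (U :&: W) = d: some family b of d elements of U maps to a basis of *)
(* the quotient.                                                              *)
Definition quotient_dim (F : fieldType) (V : lmodType F) (U W : V -> Prop)
    (d : nat) : Prop :=
  exists b : 'I_d -> V,
    [/\ forall i, U (b i),
        forall v, U v -> exists c : 'I_d -> F, W (v - \sum_i c i *: b i)
      & forall c : 'I_d -> F, W (\sum_i c i *: b i) -> forall i, c i = 0].

Definition trace_codim (F : fieldType) (A : algType F) (tr : trace A)
    (n d : nat) : Prop :=
  quotient_dim (@MT F n) (trace_identity tr) d.

Section C2.
Variable F : fieldType.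

Definition C2_pred : {pred 'M[F]_2} :=
  [pred M : 'M[F]_2 | (M 1 0 == 0) && (M 0 0 == M 1 1)].

Lemma C2_subalg_closed : subalg_closed C2_pred.
Proof.
split=> [|c M N|M N]; rewrite !inE !mxE ?eqxx //=.
  by move=> /andP[/eqP-> /eqP->] /andP[/eqP-> /eqP->]; rewrite mulr0 addr0 !eqxx.
rewrite !big_ord_recl !big_ord0 /=.
move=> /andP[/eqP M10 /eqP M00] /andP[/eqP N10 /eqP N00].
have l0 : lift ord0 ord0 = 1 :> 'I_2 by apply/val_inj.
by rewrite !l0 M10 N10 M00 N00 !(mul0r, mulr0, addr0, add0r) !eqxx.
Qed.

HB.instance Definition _ := GRing.isSubalgClosed.Build F 'M[F]_2 C2_pred
  C2_subalg_closed.

Record C2 := C2Matrix { C2_val :> 'M[F]_2; _ : C2_val \in C2_pred }.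

HB.instance Definition _ := [isSub for C2_val].
HB.instance Definition _ := [Choice of C2 by <:].
HB.instance Definition _ := [SubChoice_isSubAlgebra of C2 by <:].

Definition C2_trace_fun (alpha beta : F) (M : C2) : F :=
  alpha * C2_val M 0 0 + beta * C2_val M 0 1.

Lemma C2_trace_linear alpha beta : scalar (C2_trace_fun alpha beta).
Proof.
move=> c M N; rewrite /C2_trace_fun.
have -> : C2_val (c *: M + N) = c *: C2_val M + C2_val N.
  exact: (linearP (val : C2 -> 'M[F]_2)).
by rewrite !mxE !mulrDr !(mulrCA _ c) addrACA.
Qed.

HB.instance Definition _ alpha beta :=
  GRing.isLinear.Build F C2 F *%R (C2_trace_fun alpha beta)
    (C2_trace_linear alpha beta).

Lemma C2_mulC (M N : C2) : M * N = N * M.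
Proof.
apply: val_inj; rewrite !rmorphM /=.
case: M N => [M /= /andP[/eqP M10 /eqP M00]] [N /= /andP[/eqP N10 /eqP N00]].
have l0 : lift ord0 ord0 = 1 :> 'I_2 by apply/val_inj.
have o0 : ord0 = 0 :> 'I_2 by apply/val_inj.
apply/matrixP=> i j; rewrite !mxE !big_ord_recl !big_ord0 !l0 !addr0 !o0.
have [-> | ->] : i = 0 \/ i = 1.
- by case: i => [[|[|//]] lti]; [left | right]; apply: val_inj.
- have [-> | ->] : j = 0 \/ j = 1.
  + by case: j => [[|[|//]] ltj]; [left | right]; apply: val_inj.
  + by rewrite M10 N10 !mulr0 mulrC.
  by rewrite M00 N00 addrC; congr (_ + _); rewrite mulrC.
have [-> | ->] : j = 0 \/ j = 1.
- by case: j => [[|[|//]] ltj]; [left | right]; apply: val_inj.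
- by rewrite M10 N10 !(mulr0, mul0r).
by rewrite M10 N10 !mul0r !add0r mulrC.
Qed.

Lemma C2_traceC alpha beta (M N : C2) :
  C2_trace_fun alpha beta (M * N) = C2_trace_fun alpha beta (N * M).
Proof. by rewrite C2_mulC. Qed.

Definition C2_trace (alpha beta : F) : trace C2 :=
  @Trace F C2 (C2_trace_fun alpha beta) (C2_traceC alpha beta).

End C2.

Section Polynomials.
Variable F : fieldType.
Local Notation x1 := (tvar F 0).
Local Notation x2 := (tvar F 1).
Local Notation x3 := (tvar F 2).

Definition f1 : tpoly F := x1 * x2 - x2 * x1.

Definition h4 (alpha : F) : tpoly F :=
  Tr x1 * Tr x2 * x3 - Tr x2 * Tr x3 * x1
  + Tr (x1 * x2) * Tr x3 - Tr (x2 * x3) * Tr x1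
  - alpha *: (Tr (x1 * x2) * x3) + alpha *: (Tr (x2 * x3) * x1).

Definition h5 (alpha : F) : tpoly F :=
  - (Tr (x1 * x2) * x3) - Tr (x1 * x3) * x2 - Tr (x2 * x3) * x1
  + Tr (x1 * x2 * x3)
  + Tr x1 * x2 * x3 + Tr x2 * x1 * x3 + Tr x3 * x1 * x2
  - alpha *: (x1 * x2 * x3).

End Polynomials.

(* Main.v *)
From HB Require Import structures.
From mathcomp Require Import all_boot all_order all_algebra.
From mathcomp Require Import generic_quotient ring_quotient.
From mathcomp Require Import finmap monalg.
From mathcomp Require Import boolp ring.
Require Import Defs.

Set Implicit Arguments.
Unset Strict Implicit.
Unset Printing Implicit Defensive.

Import GRing.Theory.
Local Open Scope ring_scope.
Local Open Scope quotient_scope.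

(** Write an element of C2 as a + b e with e ^ 2 = 0, so that its trace is
    alpha a + b, and put
      d(x) = Tr(x) - alpha x,
      z(x, y) = Tr(xy) - Tr(x) y - Tr(y) x + alpha xy.
    On C2, d takes the value b - alpha b e and z takes the value - 2 b b' e.
    The generators are statements about d and z.  Modulo f1 the free algebra
    with trace is commutative.  Modulo f1, h5 says that z is a derivation in
    each argument, so that the trace of a word of length at least 3 is a
    polynomial in the letters, their traces and the z of two letters
    (nf_span_trace).  h4 is z(x1, x2) d(x3) - z(x2, x3) d(x1) (zeta_dev), and
    replacing x3 by a product x3 x4 in it gives z(x1, x2) z(x3, x4) = 0
    (zeta_zeta).

    For a word s let x_s be the product of its letters and d_s the product of
    their images by d.  Modulo the T-ideal generated by f1, h4 and h5, every
    trace polynomial is therefore a linear combination of normal forms of two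
    kinds, x_s d_u and z(x_i, x_j) d_v x_s.  By commutativity and zeta_dev, the
    second one depends only on the multisets s and u = {i, j} + v (nform_perm).
    With a_s b_u the product of the coordinates a over s and b over u, the value
    of the first kind is a_s b_u plus a multiple of e, and that of the second is
    - 2 a_s b_u e.  The functions a_s b_u are pairwise distinct multiplicative
    characters of the monoid of pairs (a, b) of sequences of scalars, because
    the characteristic is 0, hence they are linearly independent
    (characters_independent).  So no nontrivial combination of normal forms is
    an identity (tnform_independent), and an identity, which is congruent to
    such a combination, lies in the generated ideal.

    The reduction to normal forms preserves the content, that is, the multiset
    of the letters of a monomial.  Thus the multilinear normal forms on n
    letters map to a basis of the multilinear trace polynomials modulo the
    identities.  They are indexed by the set u of letters under d or z: any
    subset for the first kind, a subset of at least two elements for the second,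
    which gives 2 ^ n + (2 ^ n - n - 1) elements. *)

(** * Monoid algebras and their evaluations *)

Definition word_prod (S : nzRingType) (s : nat -> S) (w : {fmonom nat}) : S :=
  \prod_(i <- w) s i.

Lemma word_prod_mmorphism (S : nzRingType) (s : nat -> S) :
  mmorphism (word_prod s).
Proof.
by split=> [u v|]; rewrite /word_prod ?fmM ?fm1 ?big_cat ?big_nil.
Qed.

HB.instance Definition _ (S : nzRingType) (s : nat -> S) :=
  isMultiplicative.Build {fmonom nat} S (word_prod s) (word_prod_mmorphism s).

Definition cmonom_prod (I : choiceType) (S : comNzRingType) (h : I -> S)
  (m : {cmonom I}) : S := \prod_(c <- finsupp m) h c ^+ m c.

Section CommutativeMonomials.
Variables (I : choiceType) (S : comNzRingType) (h : I -> S).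

Lemma cmonom_prodEw (d : {fset I}) (m : {cmonom I}) :
  (finsupp m `<=` d)%fset -> cmonom_prod h m = \prod_(c <- d) h c ^+ m c.
Proof.
move=> le; rewrite /cmonom_prod (big_fset_incl _ le) // => c _.
by rewrite -cmE_eq0 => /eqP->.
Qed.

Lemma cmonom_prod_mmorphism : mmorphism (cmonom_prod h).
Proof.
split=> [m n|]; last by rewrite /cmonom_prod mdom1 big_seq_fset0.
rewrite (@cmonom_prodEw (finsupp m `|` finsupp n)%fset) ?mdomD //.
rewrite (@cmonom_prodEw (finsupp m `|` finsupp n)%fset m) ?fsubsetUl //.
rewrite (@cmonom_prodEw (finsupp m `|` finsupp n)%fset n) ?fsubsetUr //.
by rewrite -big_split; apply: eq_bigr => c _; rewrite cmM exprD.
Qed.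

HB.instance Definition _ :=
  isMultiplicative.Build {cmonom I} S (cmonom_prod h) cmonom_prod_mmorphism.

Lemma cmonom_prodU c : cmonom_prod h (ucm c) = h c.
Proof. by rewrite /cmonom_prod mdomU big_seq_fset1 cmUU expr1. Qed.

End CommutativeMonomials.

Section MonoidAlgebraTheory.
Variables (K : monomType) (R : nzRingType).

Lemma mon_algXM : {morph @mon_algX K R : k l / mmul k l >-> k * l}.
Proof.
by move=> k l; rewrite !mon_algXE mon_algME malgM_def fgmulUU mulr1.
Qed.

Lemma mon_algX1 : mon_algX (mone : K) = 1 :> mon_alg K R.
Proof. by rewrite mon_algXE. Qed.

Lemma mon_algUE c (k : K) :
  (<< c *g k >> : {malg R[K]}) = mon_algC K c * mon_algX k :> mon_alg K R.
Proof.
by rewrite mon_algME mon_algCE mon_algXE malgM_def fgmulUU mulr1 mul1m.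
Qed.

Lemma mon_alg_sumE (f : mon_alg K R) :
  f = \sum_(k <- msupp (f : {malg R[K]}))
        mon_algC K ((f : {malg R[K]})@_k) * mon_algX k.
Proof.
rewrite {1}[f]monalgE; apply: eq_bigr => k _; exact: mon_algUE.
Qed.

Section Evaluation.
Variables (S : nzRingType) (phi : {rmorphism R -> S}) (h : {mmorphism K -> S}).
Hypothesis phi_central : forall c s, phi c * s = s * phi c.

Lemma mmap_mon_algC c : mmap phi h (mon_algC K c : {malg R[K]}) = phi c.
Proof. by rewrite mon_algCE mmapC. Qed.

Lemma mmap_mon_algX k :
  mmap phi h (mon_algX k : {malg R[K]}) = h k.
Proof.
rewrite mon_algXE mmapU -[RHS]mul1r; congr (_ * _); exact: rmorph1.
Qed.

Lemma mmap_mon_alg_monoid :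
  monoid_morphism (mmap phi h : mon_alg K R -> S).
Proof.
have [] := @commr_mmap_is_multiplicative K R S phi h
  (fun _ _ _ => phi_central _ _).
by split=> // f g; rewrite mon_algME.
Qed.

End Evaluation.
End MonoidAlgebraTheory.

(** Determines a ring morphism on commutative polynomials by its values on the
    variables. *)
Lemma mon_algX_cmonom (I : choiceType) (R : comNzRingType) (m : {cmonom I}) :
  mon_algX m = cmonom_prod (fun c => mon_algX (ucm c)) m :> mon_alg {cmonom I} R.
Proof.
have XnE (c : I) k : (mon_algX (ucm c) : mon_alg _ R) ^+ k
    = mon_algX (iter k (mmul (ucm c)) mone).
  elim: k => [|k IHk]; first by rewrite mon_algX1.
  by rewrite exprS IHk -mon_algXM.
have itE (c j : I) k : iter k (mmul (ucm c)) mone j = (k * (c == j))%N.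
  by elim: k => [|k IHk] /=; rewrite ?cm1 // cmM cmU IHk mulSn.
rewrite /cmonom_prod; under eq_bigr do rewrite XnE.
rewrite -(big_morph _ (@mon_algXM _ R) (@mon_algX1 _ R)); congr mon_algX.
apply/eqP/cmP => j.
rewrite (big_morph (fun m : {cmonom I} => m j) (fun m n => cmM j m n) (cm1 j)).
under eq_bigr do rewrite itE.
have [jm|jm] := boolP (j \in finsupp m).
  rewrite (big_fsetD1 j) //= eqxx muln1 big_seq big1 ?addn0 // => c.
  by rewrite !inE => /andP[/negPf-> _]; rewrite muln0.
rewrite big_seq big1 ?(fsfun_dflt jm) // => c cm.
by case: eqP jm => [<-|_ _]; [rewrite cm | rewrite muln0].
Qed.

Section Induction.
Variable F : fieldType.

Lemma ptrace_ind (P : ptrace F -> Prop) :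
    (forall c, P (mon_algC _ c)) -> (forall c, P (mon_algX (ucm c))) ->
    (forall p q, P p -> P q -> P (p + q)) ->
    (forall p q, P p -> P q -> P (p * q)) ->
  forall p, P p.
Proof.
move=> PC PX PD PM p; rewrite [p]mon_alg_sumE.
have P1 : P 1 by move: (PC 1); rewrite rmorph1.
have P0 : P 0 by move: (PC 0); rewrite rmorph0.
apply: (big_ind P) => // m _; apply: (PM) => //; rewrite mon_algX_cmonom.
apply: (big_ind P) => // c _.
by elim: (m c) => // k IHk; rewrite exprS; apply: (PM).
Qed.

Lemma tvar_prod (w : {fmonom nat}) : mon_algX w = tword F w.
Proof.
rewrite -[w]fmK; case: w => w /=; rewrite /tword.
elim: w => [|i w IHw]; first by rewrite big_nil -mon_algX1 -fmoneE.
rewrite big_cons -IHw -mon_algXM; congr mon_algX.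
by rewrite -[RHS]/(fmmul (fmu i) (FMonom w)) fmuE fmmulE.
Qed.

Lemma tpoly_sumE (f : tpoly F) :
  f = \sum_(w <- msupp (f : {malg _[_]}))
        pt_emb ((f : {malg (ptrace F)[_]})@_w) * tword F w.
Proof.
by rewrite {1}[f]mon_alg_sumE; apply: eq_bigr => w _; rewrite tvar_prod.
Qed.

Lemma tpoly_word_ind (P : tpoly F -> Prop) :
    (forall p w, P (pt_emb p * tword F w)) ->
    (forall f g, P f -> P g -> P (f + g)) ->
  forall f, P f.
Proof.
move=> Pw PD f; rewrite [f]tpoly_sumE; apply: (big_ind P) => //.
by move: (Pw 0 [::]); rewrite rmorph0 mul0r.
Qed.

Lemma tpoly_ind (P : tpoly F -> Prop) :
    (forall p, P (pt_emb p)) -> (forall i, P (tvar F i)) ->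
    (forall f g, P f -> P g -> P (f + g)) ->
    (forall f g, P f -> P g -> P (f * g)) ->
  forall f, P f.
Proof.
move=> PC PX PD PM f; rewrite [f]tpoly_sumE.
have P1 : P 1 by move: (PC 1); rewrite rmorph1.
have P0 : P 0 by move: (PC 0); rewrite rmorph0.
apply: (big_ind P) => // w _; apply: (PM) => //.
by apply: (big_ind P).
Qed.

End Induction.

(** * The formal trace *)

Section Traces.
Variable F : fieldType.
Implicit Types (f g : tpoly F) (p q : ptrace F).

Lemma pt_emb_central p f : pt_emb p * f = f * pt_emb p.
Proof. exact: mon_algC_comm. Qed.

Lemma tscaleE (c : F) f : c *: f = pt_emb (mon_algC _ c) * f.
Proof. by []. Qed.

Lemma tword_cat u v : tword F (u ++ v) = tword F u * tword F v.
Proof. exact: big_cat. Qed.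

Lemma mcoeff_tword w (k : {fmonom nat}) :
  (tword F w : {malg (ptrace F)[_]})@_k = (FMonom w == k)%:R.
Proof. by rewrite -(tvar_prod F (FMonom w)) mon_algXE mcoeffU1. Qed.

(** A monomial is 1 only if both its factors are, so taking the coefficient of
    1 is a ring morphism. *)
Lemma no_pure_termM f g : no_pure_term f -> no_pure_term (f * g).
Proof.
rewrite /no_pure_term mon_algME => f0.
have [mulE _] := @mcoeff1g_is_multiplicative {fmonom nat} (ptrace F).
by rewrite mulE f0 mul0r.
Qed.

Lemma no_pure_termMr f g : no_pure_term g -> no_pure_term (f * g).
Proof.
rewrite /no_pure_term mon_algME => g0.
have [mulE _] := @mcoeff1g_is_multiplicative {fmonom nat} (ptrace F).
by rewrite mulE g0 mulr0.
Qed.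

Lemma no_pure_tword w : w != [::] -> no_pure_term (tword F w).
Proof.
move=> w0; rewrite /no_pure_term mcoeff_tword fmP fm1 /=.
by rewrite (negPf w0).
Qed.

Lemma no_pure_prod w (s : nat -> tpoly F) :
    (forall i, no_pure_term (s i)) -> w != [::] ->
  no_pure_term (\prod_(i <- w) s i).
Proof. by case: w => // i w s0 _; rewrite big_cons; apply: no_pure_termM. Qed.

Lemma ptr_is_zmod_morphism : zmod_morphism (@ptr F).
Proof. exact: (@mmap_is_additive _ _ _ idfun). Qed.
HB.instance Definition _ :=
  GRing.isZmodMorphism.Build (tpoly F) (ptrace F) (@ptr F) ptr_is_zmod_morphism.

Lemma ptr_emb p f : ptr (pt_emb p * f) = p * ptr f.
Proof.
rewrite mon_algME /pt_emb mon_algCE mul_malgC /ptr.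
rewrite (mmapEw (f := idfun) (msuppZ_le _ _)) mmapE big_distrr /=.
by apply: eq_bigr => k _; rewrite mcoeffZ mulrA.
Qed.

Lemma ptr_tword w : ptr (tword F w) = tr_word F w.
Proof.
rewrite -(tvar_prod F (FMonom w)) mon_algXE /ptr.
by rewrite (mmapU (f := idfun)) mul1r.
Qed.

Lemma tr_wordE (u : nword) :
  tr_word F (val u) = mon_algX (ucm (\pi_cycword u)).
Proof. by rewrite /tr_word valK. Qed.

Lemma tr_word_repr (c : cycword) :
  mon_algX (ucm c) = tr_word F (val (repr c)).
Proof. by rewrite tr_wordE reprK. Qed.

Lemma tr_word_catC u v : tr_word F (u ++ v) = tr_word F (v ++ u).
Proof.
have [uv0|uv0] := eqVneq (u ++ v) [::].
  by case: u v uv0 => [|i u] [].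
have vu0 : v ++ u != [::] by case: u v uv0 => [|i u] [].
rewrite -[u ++ v]/(val (Sub (u ++ v) uv0 : nword)).
rewrite -[v ++ u]/(val (Sub (v ++ u) vu0 : nword)) !tr_wordE.
congr (mon_algX (ucm _)); apply/eqmodP; apply/rotationsP.
by exists (size u); rewrite /= rot_size_cat.
Qed.

Lemma ptrC f g : ptr (f * g) = ptr (g * f).
Proof.
elim/tpoly_word_ind: f => [p u|f1 f2 IH1 IH2]; last first.
  by rewrite mulrDl mulrDr !raddfD /= IH1 IH2.
elim/tpoly_word_ind: g => [q v|g1 g2 IH1 IH2]; last first.
  by rewrite mulrDl mulrDr !raddfD /= IH1 IH2.
rewrite -mulrA (mulrA (tword F u)) -(pt_emb_central q) -mulrA !ptr_emb.
rewrite -mulrA (mulrA (tword F v)) -(pt_emb_central p) -mulrA !ptr_emb.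
by rewrite -!tword_cat !ptr_tword tr_word_catC mulrCA.
Qed.

Lemma Tr_central f g : Tr f * g = g * Tr f.
Proof. exact: pt_emb_central. Qed.

Lemma TrC f g : Tr (f * g) = Tr (g * f).
Proof. by rewrite /Tr ptrC. Qed.

End Traces.

(** * Evaluation at elements of an algebra with trace *)

(** Both the evaluation of trace polynomials in an algebra with trace (C = F)
    and the endomorphisms of the free algebra with trace (S = F<X, Tr>, C its
    ring of pure trace polynomials) send Tr to a trace tau on S with values in
    a commutative ring C that acts centrally on S by iota. *)
Section GeneralEvaluation.
Variables (F : fieldType) (S : nzRingType) (C : comNzRingType).
Variables (phi : {rmorphism F -> C}) (iota : {rmorphism C -> S}).
Variable (tau : {additive S -> C}).
Hypothesis iota_central : forall c s, iota c * s = s * iota c.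
Hypothesis tauZ : forall c s, tau (iota c * s) = c * tau s.
Hypothesis tauC : forall s t, tau (s * t) = tau (t * s).
Variable a : nat -> S.

Definition trace_coef : ptrace F -> C :=
  pt_map phi (fun c => tau (\prod_(i <- val (repr c)) a i)).

Definition trace_eval (f : tpoly F) : S :=
  mmap (iota \o trace_coef) (word_prod a) (f : {malg (ptrace F)[_]}).

Let trace_val (c : cycword) := tau (\prod_(i <- val (repr c)) a i).

Lemma trace_coef_is_zmod_morphism : zmod_morphism trace_coef.
Proof. exact: (@mmap_is_additive _ _ _ phi (cmonom_prod trace_val)). Qed.

Lemma trace_coef_is_monoid_morphism : monoid_morphism trace_coef.
Proof.
by apply: (@mmap_mon_alg_monoid _ _ _ phi (cmonom_prod trace_val)) => c s;
  rewrite mulrC.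
Qed.

HB.instance Definition _ :=
  GRing.isZmodMorphism.Build (ptrace F) C trace_coef
    trace_coef_is_zmod_morphism.
HB.instance Definition _ :=
  GRing.isMonoidMorphism.Build (ptrace F) C trace_coef
    trace_coef_is_monoid_morphism.

Lemma trace_eval_is_zmod_morphism : zmod_morphism trace_eval.
Proof. exact: (@mmap_is_additive _ _ _ (iota \o trace_coef)). Qed.

Lemma trace_eval_is_monoid_morphism : monoid_morphism trace_eval.
Proof.
by apply: (@mmap_mon_alg_monoid _ _ _ (iota \o trace_coef) (word_prod a)) => c s;
  rewrite /= iota_central.
Qed.

HB.instance Definition _ :=
  GRing.isZmodMorphism.Build (tpoly F) S trace_eval trace_eval_is_zmod_morphism.

Let teM := trace_eval_is_monoid_morphism.

Lemma trace_evalC p : trace_eval (pt_emb p) = iota (trace_coef p).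
Proof.
exact: (mmap_mon_algC (iota \o trace_coef) (word_prod a)).
Qed.

Lemma trace_evalX i : trace_eval (tvar F i) = a i.
Proof.
rewrite /trace_eval (mmap_mon_algX (iota \o trace_coef) (word_prod a)) /=.
by rewrite /word_prod fmU big_seq1.
Qed.

Lemma trace_eval_word w : trace_eval (tword F w) = \prod_(i <- w) a i.
Proof.
rewrite (big_morph _ teM.2 teM.1); apply: eq_bigr => i _; exact: trace_evalX.
Qed.

Lemma trace_coefC c : trace_coef (mon_algC _ c) = phi c.
Proof. exact: (mmap_mon_algC phi (cmonom_prod trace_val)). Qed.

Lemma trace_coefU c : trace_coef (mon_algX (ucm c)) = trace_val c.
Proof.
by apply: etrans (mmap_mon_algX phi (cmonom_prod trace_val) _) _;
  apply: cmonom_prodU.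
Qed.

(** The representative chosen in a class of cyclic words is a rotation of w,
    and tau takes the same value on the rotations of a product. *)
Lemma trace_coefX w : w != [::] ->
  trace_coef (tr_word F w) = tau (\prod_(i <- w) a i).
Proof.
move=> w0; rewrite -[w]/(val (Sub w w0 : nword)) tr_wordE.
rewrite trace_coefU.
have: \pi_cycword (repr (\pi_cycword (Sub w w0))) = \pi_cycword (Sub w w0 : nword).
  by rewrite reprK.
move/eqmodP/rotationsP => [i def_w]; rewrite /trace_val [in RHS]def_w.
by rewrite big_cat tauC -big_cat cat_take_drop.
Qed.

(** A pure term has to be excluded because the formal trace vanishes on 1,
    unlike tau in general. *)
Lemma trace_eval_Tr f :
  no_pure_term f -> trace_eval (Tr f) = iota (tau (trace_eval f)).
Proof.
move=> f0; rewrite /Tr trace_evalC; congr (iota _).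
have term_eq w : trace_coef (ptr (pt_emb ((f : {malg _[_]})@_w) * tword F w))
    = tau (trace_eval (pt_emb ((f : {malg _[_]})@_w) * tword F w)).
  rewrite ptr_emb rmorphM teM.2 trace_evalC tauZ trace_eval_word ptr_tword.
  have [w1|w0] := eqVneq (w : seq nat) [::]; last by rewrite /= trace_coefX.
  suff -> : (f : {malg _[_]})@_w = 0 by rewrite !rmorph0 !mul0r.
  suff -> : w = mone by [].
  by apply/eqP; rewrite fmP fm1 w1.
rewrite [in LHS](tpoly_sumE f) [in RHS](tpoly_sumE f).
rewrite (raddf_sum (@ptr F)) (raddf_sum trace_coef) (raddf_sum trace_eval).
by rewrite (raddf_sum tau); apply: eq_bigr => w _; apply: term_eq.
Qed.

Lemma trace_evalZ c f : trace_eval (c *: f) = iota (phi c) * trace_eval f.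
Proof. by rewrite tscaleE teM.2 trace_evalC trace_coefC. Qed.

End GeneralEvaluation.

Section TraceIdentities.
Variables (F : fieldType) (A : algType F) (tr : trace A).

Lemma tevalE (a : nat -> A) f :
  teval tr a f = trace_eval idfun (in_alg A) tr a f.
Proof. by []. Qed.

Lemma in_alg_central (c : F) (s : A) : in_alg A c * s = s * in_alg A c.
Proof. by rewrite /= mulr_algl mulr_algr. Qed.

Lemma trace_in_alg c (s : A) : tr (in_alg A c * s) = c * tr s.
Proof. by rewrite /= mulr_algl linearZ. Qed.

Section OnePoint.
Variable a : nat -> A.

HB.instance Definition _ :=
  GRing.isZmodMorphism.Build (tpoly F) A (teval tr a)
    (trace_eval_is_zmod_morphism idfun (in_alg A) tr a).
HB.instance Definition _ :=
  GRing.isMonoidMorphism.Build (tpoly F) A (teval tr a)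
    (trace_eval_is_monoid_morphism idfun tr in_alg_central a).

Lemma teval_tvar i : teval tr a (tvar F i) = a i.
Proof. exact: (trace_evalX idfun (in_alg A) tr a i). Qed.

Lemma teval_tword w : teval tr a (tword F w) = \prod_(i <- w) a i.
Proof. by rewrite rmorph_prod; apply: eq_bigr => i _; apply: teval_tvar. Qed.

Lemma teval_Tr f : no_pure_term f -> teval tr a (Tr f) = (tr (teval tr a f))%:A.
Proof.
exact: (trace_eval_Tr idfun in_alg_central trace_in_alg (traceC tr) a).
Qed.

Lemma teval_Tr_tword w : w != [::] ->
  teval tr a (Tr (tword F w)) = (tr (\prod_(i <- w) a i))%:A.
Proof. by move=> w0; rewrite (teval_Tr (no_pure_tword F w0)) teval_tword. Qed.

Lemma tevalZ c f : teval tr a (c *: f) = c *: teval tr a f.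
Proof.
rewrite tevalE (trace_evalZ idfun tr in_alg_central a c f) /=.
exact: mulr_algl.
Qed.

End OnePoint.
End TraceIdentities.

Section Substitution.
Variables (F : fieldType) (s : nat -> tpoly F).

Lemma tsubstE f :
  tsubst s f = trace_eval (mon_algC {cmonom cycword}) (@pt_emb F) (@ptr F) s f.
Proof. by []. Qed.

HB.instance Definition _ :=
  GRing.isZmodMorphism.Build (tpoly F) (tpoly F) (tsubst s)
    (trace_eval_is_zmod_morphism (mon_algC _) (@pt_emb F) (@ptr F) s).
HB.instance Definition _ :=
  GRing.isMonoidMorphism.Build (tpoly F) (tpoly F) (tsubst s)
    (trace_eval_is_monoid_morphism (mon_algC _) (@ptr F) (@pt_emb_central F) s).

Lemma tsubst_tvar i : tsubst s (tvar F i) = s i.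
Proof. exact: (trace_evalX (mon_algC _) (@pt_emb F) (@ptr F) s i). Qed.

Lemma tsubst_Tr f : no_pure_term f -> tsubst s (Tr f) = Tr (tsubst s f).
Proof.
exact: (trace_eval_Tr (mon_algC _) (@pt_emb_central F) (@ptr_emb F) (@ptrC F)).
Qed.

Lemma tsubst_tword w : tsubst s (tword F w) = \prod_(i <- w) s i.
Proof. by rewrite rmorph_prod; apply: eq_bigr => i _; apply: tsubst_tvar. Qed.

Lemma tsubst_Tr_tword w : w != [::] ->
  tsubst s (Tr (tword F w)) = Tr (\prod_(i <- w) s i).
Proof. by move=> w0; rewrite (tsubst_Tr (no_pure_tword F w0)) tsubst_tword. Qed.

Lemma tsubstZ c f : tsubst s (c *: f) = c *: tsubst s f.
Proof.
by rewrite !tsubstE (trace_evalZ (mon_algC _) (@ptr F) (@pt_emb_central F)).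
Qed.

End Substitution.

(** * Trace T-ideals *)

Section IdentitiesFormAnIdeal.
Variables (F : fieldType) (A : algType F) (tr : trace A).

(** Both sides are ring morphisms in f, so it suffices to compare them on
    letters and on the traces of words. *)
Lemma teval_tsubst (a : nat -> A) (s : nat -> tpoly F) f :
    (forall i, no_pure_term (s i)) ->
  teval tr a (tsubst s f) = teval tr (fun i => teval tr a (s i)) f.
Proof.
move=> s0; elim/tpoly_ind: f => [p|i|f g IHf IHg|f g IHf IHg]; first 1 last.
- by rewrite tsubst_tvar !teval_tvar.
- by rewrite !raddfD /= IHf IHg.
- by rewrite !rmorphM /= IHf IHg.
elim/ptrace_ind: p => [c|c|p q IHp IHq|p q IHp IHq].
- have -> : pt_emb (mon_algC _ c) = c *: 1 :> tpoly F by rewrite tscaleE mulr1.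
  by rewrite tsubstZ !tevalZ !rmorph1.
- rewrite tr_word_repr -ptr_tword -/(Tr _); have c0 := valP (repr c).
  have w0 : no_pure_term (tword F (val (repr c))) by apply: no_pure_tword.
  rewrite tsubst_Tr // teval_Tr; last first.
    by rewrite tsubst_tword; apply: no_pure_prod.
  by rewrite tsubst_tword rmorph_prod teval_Tr // teval_tword.
- by rewrite !raddfD /= IHp IHq.
- by rewrite !rmorphM /= IHp IHq.
Qed.

Lemma trace_identity_ideal : Ttr_ideal (trace_identity tr).
Proof.
split=> [a|f g f0 g0 a|f g g0 a|f g f0 a|s f s0 f0 a|f w w0 f0 a|f f1 f0 a].
- exact: raddf0.
- by rewrite raddfD /= f0 g0 addr0.
- by rewrite rmorphM /= g0 mulr0.
- by rewrite rmorphM /= f0 mul0r.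
- by rewrite teval_tsubst.
- rewrite teval_Tr; last by apply/no_pure_termMr/no_pure_tword.
  by rewrite rmorphM /= f0 mul0r raddf0 scale0r.
- by rewrite teval_Tr // f0 raddf0 scale0r.
Qed.

End IdentitiesFormAnIdeal.

Lemma Ttr_generated_ideal (F : fieldType) (S : tpoly F -> Prop) :
  Ttr_ideal (Ttr_generated S).
Proof.
split=> [I [] //|f g fS gS I I_id SI|f g gS I I_id SI|f g fS I I_id SI
        |s f s0 fS I I_id SI|f w w0 fS I I_id SI|f f0 fS I I_id SI].
- by apply: Ttr_idealD => //; [apply: fS | apply: gS].
- by apply: Ttr_idealMl => //; apply: gS.
- by apply: Ttr_idealMr => //; apply: fS.
- by apply: Ttr_ideal_subst => //; apply: fS.
- by apply: Ttr_ideal_TrM => //; apply: fS.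
- by apply: Ttr_ideal_Tr => //; apply: fS.
Qed.

Lemma Ttr_generated_sub (F : fieldType) (S : tpoly F -> Prop) f :
  S f -> Ttr_generated S f.
Proof. by move=> Sf I _; apply. Qed.

(** * Normal forms and their relations *)

(** Adjacent transpositions generate all permutations. *)
Lemma swap_perm_eq (X : eqType) (Y : Type) (B : seq X -> Y) :
    (forall p i j q, B (p ++ i :: j :: q) = B (p ++ j :: i :: q)) ->
  forall u v, perm_eq u v -> B u = B v.
Proof.
move=> Bswap.
have Bmove p i s q : B (p ++ i :: s ++ q) = B (p ++ s ++ i :: q).
  elim: s p => [//|j s IHs] p /=.
  by rewrite Bswap -cat_rcons IHs cat_rcons.
suff Bperm p u v : perm_eq u v -> B (p ++ u) = B (p ++ v) by apply: (Bperm [::]).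
elim: u p v => [|i u IHu] p v; first by rewrite perm_sym => /perm_nilP->.
move=> uv; have iv : i \in v by rewrite -(perm_mem uv) mem_head.
case/splitPr: iv uv => v1 v2; rewrite perm_sym perm_catC /= perm_cons.
rewrite perm_sym => uv; rewrite -Bmove -!cat_rcons; apply: IHu.
by rewrite (permPl uv) perm_catC.
Qed.

Section NormalFormDefinition.
Variables (F : fieldType) (alpha : F) (Q : pzRingType).
Variables (k : F -> Q) (x : nat -> Q) (T : seq nat -> Q).

(** On dual numbers a + b e this is b - alpha b e: up to a multiple of e, it
    extracts the second coordinate. *)
Definition dev i : Q := T [:: i] - k alpha * x i.

(** On dual numbers this is - 2 b b' e, for the second coordinates b and b'. *)
Definition zeta i j : Q :=
  T [:: i; j] - T [:: i] * x j - T [:: j] * x i + k alpha * (x i * x j).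

(** The first two letters of u go to zeta for the second kind of normal form;
    the value 0 for shorter u is a default, excluded by nf_valid. *)
Definition nform (b : bool) (s u : seq nat) : Q :=
  let X := \prod_(i <- s) x i in
  let D v := \prod_(i <- v) dev i in
  if b then if u is i :: j :: v then zeta i j * X * D v else 0 else X * D u.

End NormalFormDefinition.

Lemma nform_morph (F : fieldType) (alpha : F) (Q Q' : pzRingType)
    (g : {rmorphism Q -> Q'}) k k' x x' T T' :
    (forall c, g (k c) = k' c) -> (forall i, g (x i) = x' i) ->
    (forall w, w != [::] -> g (T w) = T' w) ->
  forall b s u, g (nform alpha k x T b s u) = nform alpha k' x' T' b s u.
Proof.
move=> gk gx gT b s u.
have gdev i : g (dev alpha k x T i) = dev alpha k' x' T' i.
  by rewrite rmorphB rmorphM /= gT // gk gx.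
have gX w : g (\prod_(i <- w) x i) = \prod_(i <- w) x' i.
  by rewrite rmorph_prod; apply: eq_bigr.
have gD w : g (\prod_(i <- w) dev alpha k x T i)
    = \prod_(i <- w) dev alpha k' x' T' i.
  by rewrite rmorph_prod; apply: eq_bigr.
rewrite /nform; case: b; last by rewrite rmorphM /= gX gD.
case: u => [|i [|j u]]; rewrite ?rmorph0 // !rmorphM /= gX gD.
by rewrite rmorphD !rmorphB !rmorphM /= !gT // !gx gk.
Qed.

Definition nf_index := (bool * (seq nat * seq nat))%type.

Definition nf_valid : pred nf_index := fun e => e.1 ==> (1 < size e.2.2)%N.

Definition nf_content (m : seq nat) : pred nf_index :=
  fun e => nf_valid e && perm_eq (e.2.1 ++ e.2.2) m.

Section NormalForms.
Variables (F : fieldType) (alpha : F) (Q : comPzRingType).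
Variables (k : {rmorphism F -> Q}) (x : nat -> Q) (T : seq nat -> Q).

Local Notation a := (k alpha).
Local Notation X w := (\prod_(i <- w) x i).

Definition h4_relation := forall u v w,
  u != [::] -> v != [::] -> w != [::] ->
  T u * T v * X w - T v * T w * X u + T (u ++ v) * T w - T (v ++ w) * T u
    - a * (T (u ++ v) * X w) + a * (T (v ++ w) * X u) = 0.

Definition h5_relation := forall u v w,
  u != [::] -> v != [::] -> w != [::] ->
  - (T (u ++ v) * X w) - T (u ++ w) * X v - T (v ++ w) * X u + T (u ++ v ++ w)
    + T u * X v * X w + T v * X u * X w + T w * X u * X v
    - a * (X u * X v * X w) = 0.

Hypothesis TC : forall u v, T (u ++ v) = T (v ++ u).
Hypotheses (H4 : h4_relation) (H5 : h5_relation).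

Local Notation dev := (dev alpha k x T).
Local Notation zeta := (zeta alpha k x T).
Local Notation nform := (nform alpha k x T).
Local Notation D u := (\prod_(i <- u) dev i).

Lemma zetaC i j : zeta i j = zeta j i.
Proof. by rewrite /zeta (TC [:: i] [:: j]) /=; ring. Qed.

(** The difference of the two sides is the relation h4 on three letters. *)
Lemma zeta_dev i j l : zeta i j * dev l = zeta j l * dev i.
Proof.
apply/eqP; rewrite -subr_eq0; apply/eqP.
rewrite -(@H4 [:: i] [:: j] [:: l]) //= !big_seq1 /zeta /dev; ring.
Qed.

(** Put lm for the product of the letters l and m. The relation h4 on i, j, lm
    says that zeta(i, j) dev(lm) = zeta(j, lm) dev(i). Here dev(lm) is
    zeta(l, m) + dev(l) x_m + dev(m) x_l, while zeta(j, lm) is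
    zeta(j, l) x_m + zeta(j, m) x_l by h5, so that zeta_dev cancels everything
    but zeta(i, j) zeta(l, m). *)
Lemma zeta_zeta i j l m : zeta i j * zeta l m = 0.
Proof.
have h4l := @H4 [:: i] [:: j] [:: l] isT isT isT.
have h4m := @H4 [:: i] [:: j] [:: m] isT isT isT.
have h4lm := @H4 [:: i] [:: j] [:: l; m] isT isT isT.
have h5 := @H5 [:: j] [:: l] [:: m] isT isT isT.
(* the product is a combination of relations; each 0 stands for one of them *)
transitivity (0 + dev i * 0 - x m * 0 - x l * 0); last by ring.
rewrite -{1}h4lm -{1}h5 -{1}h4l -{1}h4m /= !big_cons !big_nil /zeta /dev.
ring.
Qed.

(** The only letters that do not commute visibly are those inside zeta: they
    are exchanged with each other by zetaC, and with those under dev by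
    zeta_dev. *)
Lemma nform_perm b s s' u u' :
  perm_eq s s' -> perm_eq u u' -> nform b s u = nform b s' u'.
Proof.
move=> ss' uu'; have XE : X s = X s' by apply: perm_big.
transitivity (nform b s' u).
  by rewrite /nform /=; case: b u {uu'} => [[|i [|j u]]|u]; rewrite ?XE.
case: b; last by rewrite /nform /=; congr (_ * _); apply: perm_big.
apply: (swap_perm_eq _ uu') => [[|i [|j p]] l m q] /=.
- by rewrite zetaC.
- by rewrite !big_cons mulrACA [RHS]mulrACA (zetaC i m) (zeta_dev m i l).
- rewrite !big_cat !big_cons /=; ring.
Qed.

Lemma nform_mul0 b s u s' u' : (b ==> (1 < size u)%N) ->
  nform b s u * nform false s' u' = nform b (s ++ s') (u ++ u').
Proof.
by case: b u => [[|i [|j u]] //|u] _ /=; rewrite !big_cat /=; ring.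
Qed.

(** On dual numbers the second kind of normal forms lies in the ideal spanned
    by e, whose square is 0. *)
Lemma nform_mul11 s u s' u' : nform true s u * nform true s' u' = 0.
Proof.
case: u u' => [|i [|j u]] [|l [|m v]] /=; rewrite ?mul0r ?mulr0 //.
by rewrite mulrACA (mulrACA (zeta i j)) zeta_zeta !mul0r.
Qed.

(** The F-span of the normal forms with indices in P. *)
Inductive nf_span (P : pred nf_index) : Q -> Prop :=
| nf_span0 : nf_span P 0
| nf_spanS c e q : P e -> nf_span P q ->
    nf_span P (k c * nform e.1 e.2.1 e.2.2 + q).

Lemma nf_spanW (P P' : pred nf_index) q :
  (forall e, P e -> P' e) -> nf_span P q -> nf_span P' q.
Proof.
move=> PP'; elim=> [|c e r Pe _ IHr]; first exact: nf_span0.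
by apply: nf_spanS => //; apply: PP'.
Qed.

Lemma nf_span_perm m m' q :
  perm_eq m m' -> nf_span (nf_content m) q -> nf_span (nf_content m') q.
Proof.
move=> mm'; apply: nf_spanW => e /andP[e2 em].
by rewrite /nf_content e2 (perm_trans em).
Qed.

Lemma nf_span_nform (P : pred nf_index) b s u :
  P (b, (s, u)) -> nf_span P (nform b s u).
Proof.
move=> ok; rewrite -[nform _ _ _]mul1r -(rmorph1 k) -[_ * _]addr0.
exact: (nf_spanS _ ok (nf_span0 P)).
Qed.

Lemma nf_spanD P p q : nf_span P p -> nf_span P q -> nf_span P (p + q).
Proof.
elim=> [|c e r ok _ IHr] mq; first by rewrite add0r.
by rewrite -addrA; apply: nf_spanS => //; apply: IHr.
Qed.

Lemma nf_spanZ P c q : nf_span P q -> nf_span P (k c * q).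
Proof.
elim=> [|d e r ok _ IHr]; first by rewrite mulr0; apply: nf_span0.
by rewrite mulrDr mulrA -rmorphM; apply: nf_spanS.
Qed.

Lemma nf_spanN P q : nf_span P q -> nf_span P (- q).
Proof. by rewrite -mulN1r -(rmorph1 k) -rmorphN; apply: nf_spanZ. Qed.

Lemma nf_content_cat m m' b b' s s' u u' :
    nf_content m (b, (s, u)) -> nf_content m' (b', (s', u')) -> 
  perm_eq ((s ++ s') ++ (u ++ u')) (m ++ m').
Proof.
move=> /andP[_ /= /permP sm] /andP[_ /= /permP sm']; apply/permP => y.
by rewrite !count_cat -sm -sm' !count_cat addnACA.
Qed.

Lemma nf_span_nform_mul m m' e e' : nf_content m e -> nf_content m' e' ->
  nf_span (nf_content (m ++ m')) (nform e.1 e.2.1 e.2.2 * nform e'.1 e'.2.1 e'.2.2).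
Proof.
case: e e' => [b [s u]] [b' [s' u']] ok ok' /=.
have [e2 _] := andP ok; have [e2' _] := andP ok'.
case: b' ok' e2' => [ok' e2'|ok' _]; last first.
  rewrite nform_mul0 //; apply/nf_span_nform/andP; split; last first.
    exact: nf_content_cat ok ok'.
  by case: b ok e2 => // _ e2; rewrite /nf_valid /= size_cat ltn_addr.
case: b ok e2 => [_ _|ok _]; first by rewrite nform_mul11; apply: nf_span0.
rewrite mulrC nform_mul0 //; apply/nf_span_nform/andP; split.
  by rewrite /nf_valid /= size_cat ltn_addr.
apply: (perm_trans (nf_content_cat ok' ok)); exact: permEl (perm_catC _ _).
Qed.

Lemma nf_span_mul (P P' P'' : pred nf_index) p q :
    (forall e e', P e -> P' e' -> nf_span P''
       (nform e.1 e.2.1 e.2.2 * nform e'.1 e'.2.1 e'.2.2)) ->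
  nf_span P p -> nf_span P' q -> nf_span P'' (p * q).
Proof.
move=> PP''; elim=> [|c e r ok _ IHr] mq; first by rewrite mul0r; apply: nf_span0.
rewrite mulrDl; apply: nf_spanD; last exact: IHr.
elim: mq => [|c' e' r' ok' _ IHr']; first by rewrite mulr0; apply: nf_span0.
rewrite mulrDr mulrACA -rmorphM; apply: nf_spanD => //.
exact/nf_spanZ/PP''.
Qed.

Lemma nf_spanM m m' p q : nf_span (nf_content m) p -> nf_span (nf_content m') q ->
  nf_span (nf_content (m ++ m')) (p * q).
Proof. apply: nf_span_mul; exact: nf_span_nform_mul. Qed.

Lemma nf_span_validM p q :
  nf_span nf_valid p -> nf_span nf_valid q -> nf_span nf_valid (p * q).
Proof.
apply: nf_span_mul => e e' e2 e2'.
have ok e0 : nf_valid e0 -> nf_content (e0.2.1 ++ e0.2.2) e0.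
  by rewrite /nf_content perm_refl andbT.
by apply: nf_spanW (nf_span_nform_mul (ok e e2) (ok e' e2')) => e0 /andP[].
Qed.

Lemma nf_span_letters w : nf_span (nf_content w) (X w).
Proof.
have -> : X w = nform false w [::] by rewrite /nform big_nil mulr1.
by apply: nf_span_nform; rewrite /nf_content /= cats0.
Qed.

Lemma nf_span_trace1 i : nf_span (nf_content [:: i]) (T [:: i]).
Proof.
have -> : T [:: i] = nform false [::] [:: i] + k alpha * X [:: i].
  by rewrite /nform !big_cons !big_nil /dev; ring.
apply: nf_spanD; first by apply: nf_span_nform; rewrite /nf_content /=.
exact/nf_spanZ/nf_span_letters.
Qed.

Lemma nf_span_trace2 i j : nf_span (nf_content [:: i; j]) (T [:: i; j]).
Proof.
have -> : T [:: i; j] = nform true [::] [:: i; j] + T [:: i] * X [:: j]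
    + X [:: i] * T [:: j] - k alpha * X [:: i; j].
  by rewrite /nform !big_cons !big_nil /zeta; ring.
apply: nf_spanD; last exact/nf_spanN/nf_spanZ/nf_span_letters.
apply: nf_spanD; last exact: (nf_spanM (nf_span_letters [:: i]) (nf_span_trace1 j)).
apply: nf_spanD; last exact: (nf_spanM (nf_span_trace1 i) (nf_span_letters [:: j])).
by apply: nf_span_nform; rewrite /nf_content /=.
Qed.

(** The relation h5 on i, j and the remaining word expresses the trace of a
    word of length at least 3 by traces of shorter words. *)
Lemma nf_span_trace w : w != [::] -> nf_span (nf_content w) (T w).
Proof.
have [n] := ubnP (size w); elim: n w => // n IHn [|i [|j [|l w]]] //= sz _.
- exact: nf_span_trace1.
- exact: nf_span_trace2.
set v := l :: w; have v0 : v != [::] by [].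
have tv : nf_span (nf_content v) (T v) by apply: IHn => //; rewrite ltnW.
have tiv : nf_span (nf_content (i :: v)) (T (i :: v)) by apply: IHn.
have tjv : nf_span (nf_content (j :: v)) (T (j :: v)) by apply: IHn.
have ti := nf_span_trace1 i; have tj := nf_span_trace1 j.
have xi := nf_span_letters [:: i]; have xj := nf_span_letters [:: j].
have xv := nf_span_letters v.
have -> : T [:: i, j & v] = T [:: i; j] * X v + X [:: j] * T (i :: v)
    + X [:: i] * T (j :: v)
    + (- (T [:: i] * (X [:: j] * X v)) - X [:: i] * (T [:: j] * X v)
       - X [:: i] * (X [:: j] * T v) + k alpha * (X [:: i] * (X [:: j] * X v))).
  apply/eqP; rewrite -subr_eq0 -(@H5 [:: i] [:: j] v) //=; apply/eqP; ring.
have sw : perm_eq ([:: j] ++ i :: v) [:: i, j & v].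
  by rewrite (perm_catCA [:: j] [:: i] v).
repeat (apply: nf_spanD).
- exact: (nf_spanM (nf_span_trace2 i j) xv).
- exact: (nf_span_perm sw (nf_spanM xj tiv)).
- exact: (nf_spanM xi tjv).
- exact: (nf_spanN (nf_spanM ti (nf_spanM xj xv))).
- exact: (nf_spanN (nf_spanM xi (nf_spanM tj xv))).
- exact: (nf_spanN (nf_spanM xi (nf_spanM xj tv))).
- exact: (nf_spanZ _ (nf_spanM xi (nf_spanM xj xv))).
Qed.

Definition nf_canon (e : nf_index) : nf_index :=
  (e.1, (sort leq e.2.1, sort leq e.2.2)).

(** By nform_perm, sorting both words of an index does not change its normal
    form; the terms with equal sorted indices are then collected. *)
Lemma nf_span_canon (P : pred nf_index) q :
    (forall e, P e -> P (nf_canon e)) -> nf_span P q ->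
  exists (r : seq nf_index) (c : nf_index -> F),
    [/\ uniq r, all P r, all (fun e => nf_canon e == e) r
      & q = \sum_(e <- r) k (c e) * nform e.1 e.2.1 e.2.2].
Proof.
move=> Pcanon; elim=> [|c e p Pe _ [r [c' [r_uniq rP r_can ->]]]].
  by exists [::], (fun=> 0); rewrite big_nil.
have [e' [can_e' Pe' ->]] : exists e', [/\ nf_canon e' = e', P e' &
    nform e.1 e.2.1 e.2.2 = nform e'.1 e'.2.1 e'.2.2].
  exists (nf_canon e); split; [|exact: Pcanon|].
    by rewrite /nf_canon /= !(sorted_sort leq_trans (sort_sorted leq_total _)).
  by apply: nform_perm; rewrite perm_sym perm_sort.
have [er|er] := boolP (e' \in r).
  exists r, (fun f => c' f + c *+ (f == e')); split=> //.
  rewrite [RHS](bigD1_seq e') //= [in LHS](bigD1_seq e') //= eqxx.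
  rewrite rmorphD mulrDl -addrA addrCA; congr (_ + (_ + _)).
  by apply: eq_bigr => f /negPf->; rewrite addr0.
exists (e' :: r), (fun f => if f == e' then c else c' f); split=> /=.
- by rewrite er.
- by rewrite Pe'.
- by rewrite can_e' eqxx.
rewrite big_cons eqxx; congr (_ + _); apply: eq_big_seq => f fr.
by case: eqP er => // <-; rewrite fr.
Qed.

End NormalForms.

(** * The quotient by the generated T-ideal *)

Section Quotient.
Variables (F : fieldType) (alpha : F).

Definition gens (g : tpoly F) := [\/ g = f1 F, g = h4 alpha | g = h5 alpha].

Local Notation I := (Ttr_generated gens).

Let I_ideal : Ttr_ideal I := Ttr_generated_ideal gens.

(** Membership in an ideal given by an impredicative definition is undecidable;
    quotients need a boolean predicate. *)
Definition in_gen : {pred tpoly F} := fun f => `[< I f >].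

Lemma in_genP f : reflect (I f) (f \in in_gen).
Proof. exact: asboolP. Qed.

Lemma generated_opp f : I f -> I (- f).
Proof. by move=> If; rewrite -mulN1r; apply: (Ttr_idealMl I_ideal). Qed.

Lemma in_gen_zmod_closed : zmod_closed in_gen.
Proof.
split=> [|f g /in_genP If /in_genP Ig]; apply/in_genP;
  first exact: (Ttr_ideal0 I_ideal).
by apply: (Ttr_idealD I_ideal) => //; apply: generated_opp.
Qed.

HB.instance Definition _
  := GRing.isZmodClosed.Build (tpoly F) in_gen in_gen_zmod_closed.

Definition three_values (X : Type) (u v w : X) (i : nat) : X :=
  if i is i'.+1 then (if i' is 0%N then v else w) else u.

Lemma no_pure_three_values u v w i :
  u != [::] -> v != [::] -> w != [::] ->
  no_pure_term (three_values (tword F u) (tword F v) (tword F w) i).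
Proof. by move=> u0 v0 w0; case: i => [|[|i]]; apply: no_pure_tword. Qed.

Lemma generated_subst u v w g : u != [::] -> v != [::] -> w != [::] -> gens g ->
  I (tsubst (three_values (tword F u) (tword F v) (tword F w)) g).
Proof.
move=> u0 v0 w0 Gg; apply: (Ttr_ideal_subst I_ideal) => // [i|].
  exact: no_pure_three_values.
exact: Ttr_generated_sub.
Qed.

(** The letters commute by f1, the traces are central, and the elements that
    commute modulo an ideal with a given one form a subring. *)
Lemma generated_comm f g : I (f * g - g * f).
Proof.
have D0 a b c d : I (a - b) -> I (c - d) -> I ((a + c) - (b + d)).
  by move=> ab cd; rewrite opprD addrACA; apply: (Ttr_idealD I_ideal).
have I0 a : I (a - a) by rewrite subrr; exact: (Ttr_ideal0 I_ideal).
elim/tpoly_ind: f => [p|i|f1 f2 IH1 IH2|f1 f2 IH1 IH2].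
- by rewrite pt_emb_central.
- elim/tpoly_ind: g => [p|j|g1 g2 IH1 IH2|g1 g2 IH1 IH2].
  + by rewrite pt_emb_central.
  + have := @generated_subst [:: i] [:: j] [:: j] _ isT isT isT (Or31 _ _ erefl).
    by rewrite /f1 raddfB /= !rmorphM /= !tsubst_tvar /three_values /tword !big_seq1.
  + by rewrite mulrDr mulrDl; apply: D0.
  have -> : tvar F i * (g1 * g2) - g1 * g2 * tvar F i =
      (tvar F i * g1 - g1 * tvar F i) * g2 + g1 * (tvar F i * g2 - g2 * tvar F i).
    by rewrite mulrBl mulrBr !mulrA addrA addrNK.
  apply: (Ttr_idealD I_ideal); first exact: (Ttr_idealMr I_ideal).
  exact: (Ttr_idealMl I_ideal).
- by rewrite mulrDr mulrDl; apply: D0.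
have -> : f1 * f2 * g - g * (f1 * f2) =
    f1 * (f2 * g - g * f2) + (f1 * g - g * f1) * f2.
  by rewrite mulrBl mulrBr !mulrA addrA addrNK.
apply: (Ttr_idealD I_ideal); first exact: (Ttr_idealMl I_ideal).
exact: (Ttr_idealMr I_ideal).
Qed.

(** The relatively free algebra of the T-ideal. *)
Definition relfree := Quotient.quot (in_gen : zmodClosed (tpoly F)).
HB.instance Definition _ := GRing.Zmodule.on relfree.
HB.instance Definition _ := EqQuotient.on relfree.

Definition residue (f : tpoly F) : relfree := \pi_relfree f.

Lemma residue_eq f g : residue f = residue g <-> I (f - g).
Proof.
split=> [/eqP|Ifg]; first by rewrite -Quotient.idealrBE => /in_genP.
by apply/eqP; rewrite -Quotient.idealrBE; apply/in_genP.
Qed.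

Lemma residue_repr (q : relfree) : residue (repr q) = q.
Proof. exact: reprK. Qed.

Lemma residue_is_zmod_morphism : zmod_morphism residue.
Proof.
move=> f g; rewrite /residue.
by rewrite (raddfB (\pi_(Quotient.quot (in_gen : zmodClosed (tpoly F))))).
Qed.

HB.instance Definition _ :=
  GRing.isZmodMorphism.Build (tpoly F) relfree residue residue_is_zmod_morphism.

Lemma residue_eq0 f : residue f = 0 <-> I f.
Proof. by rewrite -[f in I f]subr0 -residue_eq raddf0. Qed.

Definition relmul (p q : relfree) : relfree := residue (repr p * repr q).

Lemma residue_mul f g : relmul (residue f) (residue g) = residue (f * g).
Proof.
apply/residue_eq.
have -> : repr (residue f) * repr (residue g) - f * g =
    (repr (residue f) - f) * repr (residue g) + f * (repr (residue g) - g).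
  by rewrite mulrBl mulrBr addrA addrNK.
apply: (Ttr_idealD I_ideal) => //.
  by apply: (Ttr_idealMr I_ideal) => //; apply/residue_eq; rewrite residue_repr.
by apply: (Ttr_idealMl I_ideal) => //; apply/residue_eq; rewrite residue_repr.
Qed.

Lemma relmulA : associative relmul.
Proof.
move=> p q r; rewrite -[p]residue_repr -[q]residue_repr -[r]residue_repr.
by rewrite !residue_mul mulrA.
Qed.

Lemma relmulC : commutative relmul.
Proof.
move=> p q; rewrite -[p]residue_repr -[q]residue_repr !residue_mul.
apply/residue_eq; exact: generated_comm.
Qed.

Lemma relmul1 : left_id (residue 1) relmul.
Proof. by move=> p; rewrite -[p]residue_repr residue_mul mul1r. Qed.

Lemma relmulDl : left_distributive relmul +%R.
Proof.
move=> p q r; rewrite -[p]residue_repr -[q]residue_repr -[r]residue_repr.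
by rewrite -raddfD !residue_mul mulrDl raddfD.
Qed.

HB.instance Definition _ :=
  GRing.Zmodule_isComPzRing.Build relfree relmulA relmulC relmul1 relmulDl.

Lemma residue_is_monoid_morphism : monoid_morphism residue.
Proof. by split=> // f g; rewrite -residue_mul. Qed.

HB.instance Definition _ :=
  GRing.isMonoidMorphism.Build (tpoly F) relfree residue residue_is_monoid_morphism.

Definition relC : F -> relfree := residue \o in_alg (tpoly F).
HB.instance Definition _ := GRing.RMorphism.on relC.

Definition relX (i : nat) : relfree := residue (tvar F i).
Definition relT (w : seq nat) : relfree := residue (Tr (tword F w)).

Lemma residueZ c f : residue (c *: f) = relC c * residue f.
Proof. by rewrite -[relC c]/(residue c%:A) -rmorphM mulr_algl. Qed.

Lemma residue_tword w : residue (tword F w) = \prod_(i <- w) relX i.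
Proof. by rewrite rmorph_prod. Qed.

Lemma relTC u v : relT (u ++ v) = relT (v ++ u).
Proof. by rewrite /relT !tword_cat TrC. Qed.

Lemma tword1 i : tword F [:: i] = tvar F i.
Proof. exact: big_seq1. Qed.
Lemma tword2 i j : tword F [:: i; j] = tvar F i * tvar F j.
Proof. by rewrite /tword big_cons big_seq1. Qed.
Lemma tword3 i j l : tword F [:: i; j; l] = tvar F i * tvar F j * tvar F l.
Proof. by rewrite /tword 2!big_cons big_seq1 mulrA. Qed.

Lemma rel_h4 : h4_relation alpha relC relX relT.
Proof.
move=> u v w u0 v0 w0; have := generated_subst u0 v0 w0 (Or32 _ _ erefl).
move/residue_eq0 => <-.
rewrite /h4 -!tword2 -!tword1.
rewrite !(raddfD, raddfN) /= !tsubstZ !residueZ !rmorphM /= !tsubst_Tr_tword //.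
rewrite !tsubst_tword !big_cons !big_nil !mulr1 /three_values -!tword_cat.
by rewrite -!residue_tword.
Qed.

Lemma rel_h5 : h5_relation alpha relC relX relT.
Proof.
move=> u v w u0 v0 w0; have := generated_subst u0 v0 w0 (Or33 _ _ erefl).
move/residue_eq0 => <-.
rewrite /h5 -!tword3 -!tword2 -!tword1.
rewrite !(raddfD, raddfN) /= !tsubstZ !residueZ !rmorphM /= !tsubst_Tr_tword //.
rewrite !tsubst_tword !big_cons !big_nil !mulr1 /three_values -!tword_cat.
by rewrite !residue_tword !big_cat /= !mulrA.
Qed.

End Quotient.

(** * Dual numbers and their identities *)

(** Coordinates on the algebra of dual numbers a + b e, where e ^ 2 = 0, with
    the trace of a + b e equal to alpha a + b; dual a b is a + b e. *)
Record dual_coordinates (F : fieldType) (alpha : F) (A : algType F)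
    (tr : trace A) := DualCoordinates {
  re : A -> F;
  eps : A -> F;
  dual : F -> F -> A;
  reD : {morph re : M N / M + N};
  epsD : {morph eps : M N / M + N};
  reM : {morph re : M N / M * N};
  epsM : forall M N, eps (M * N) = re M * eps N + eps M * re N;
  re1 : re 1 = 1;
  reZ : forall c M, re (c *: M) = c * re M;
  epsZ : forall c M, eps (c *: M) = c * eps M;
  dual_eq : forall M N, re M = re N -> eps M = eps N -> M = N;
  re_dual : forall a b, re (dual a b) = a;
  eps_dual : forall a b, eps (dual a b) = b;
  tr_dual : forall M, tr M = alpha * re M + eps M
}.

Section DualCoordinates.
Variables (F : fieldType) (alpha : F) (A : algType F) (tr : trace A).
Variable X : dual_coordinates alpha tr.

Lemma reN : {morph re X : M / - M}.
Proof. by move=> M; rewrite -scaleN1r reZ mulN1r. Qed.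

Lemma epsN : {morph eps X : M / - M}.
Proof. by move=> M; rewrite -scaleN1r epsZ mulN1r. Qed.

Lemma re0 : re X 0 = 0.
Proof. by rewrite -(scale0r 0) reZ mul0r. Qed.

Lemma eps0 : eps X 0 = 0.
Proof. by rewrite -(scale0r 0) epsZ mul0r. Qed.

Lemma eps1 : eps X 1 = 0.
Proof.
by apply: (addrI (eps X 1)); rewrite addr0 -{3}[1](mulr1 1) epsM re1 mul1r mulr1.
Qed.

Definition dualE := (reD, reN, reM, reZ, re0, re1, epsD, epsN, epsM, epsZ, eps0,
  eps1, re_dual, eps_dual).

Lemma dual_mulC (M N : A) : M * N = N * M.
Proof. by apply: (dual_eq (d := X)); rewrite !dualE; ring. Qed.

(** The two coordinates of each generator are polynomial identities in the
    coordinates of its arguments. *)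
Lemma generator_identity f : gens alpha f -> trace_identity tr f.
Proof.
case=> -> a.
- by rewrite /f1 raddfB /= !rmorphM /= !teval_tvar dual_mulC subrr.
- rewrite /h4 -!tword2 -!tword1 !(raddfD, raddfN) /= !tevalZ !rmorphM /=.
  rewrite !teval_Tr_tword // !teval_tword !big_cons !big_nil !(tr_dual X).
  by apply: (dual_eq (d := X)); rewrite !dualE; ring.
rewrite /h5 -!tword3 -!tword2 -!tword1 !(raddfD, raddfN) /= !tevalZ !rmorphM /=.
rewrite !teval_Tr_tword // !teval_tword !big_cons !big_nil !(tr_dual X).
by apply: (dual_eq (d := X)); rewrite !dualE; ring.
Qed.

Lemma generated_identity f : Ttr_generated (gens alpha) f -> trace_identity tr f.
Proof.
by move=> If; apply: If; [apply: trace_identity_ideal | apply: generator_identity].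
Qed.

End DualCoordinates.

(** * Linear independence of normal forms *)

(** Artin's argument: if chi_i v and chi_j v differ, evaluating a relation at
    v w and subtracting chi_i v times its value at w removes the term of index
    i, but not the one of index j. *)
Lemma characters_independent (F : fieldType) (V : Type) (mulV : V -> V -> V)
    (oneV : V) (J : eqType) (chi : J -> V -> F) (r : seq J) (c : J -> F) :
    (forall j v w, chi j (mulV v w) = chi j v * chi j w) ->
    (forall j, chi j oneV = 1) ->
    {in r &, forall i j, i != j -> exists v, chi i v != chi j v} ->
    uniq r -> (forall v, \sum_(j <- r) c j * chi j v = 0) ->
  {in r, forall j, c j = 0}.
Proof.
move=> chiM chi1; elim: r c => // i r IHr c sep /andP[ir r_uniq] c0.
have cr0 : {in r, forall j, c j = 0}.
  move=> j jr; have ij : i != j by apply: contraNneq ir => ->.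
  have jir : j \in i :: r by rewrite inE jr orbT.
  have [v chi_v] := sep i j (mem_head _ _) jir ij.
  have sepr : {in r &, forall i j, i != j -> exists v, chi i v != chi j v}.
    by move=> l m lr mr; apply: sep; rewrite inE ?lr ?mr orbT.
  apply: (mulIf (_ : chi j v - chi i v != 0)); first by rewrite subr_eq0 eq_sym.
  rewrite mul0r; apply: (IHr (fun l => c l * (chi l v - chi i v))) => // w.
  transitivity (\sum_(l <- i :: r) c l * chi l (mulV v w)
      - chi i v * \sum_(l <- i :: r) c l * chi l w); last first.
    by rewrite !c0 mulr0 subr0.
  rewrite !big_cons mulrDr opprD addrACA chiM mulrCA subrr add0r mulr_sumr.
  rewrite -sumrB; apply: eq_bigr => l _; rewrite chiM; ring.
move=> j; rewrite inE => /predU1P[->|/cr0//].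
have := c0 oneV; rewrite big_cons big1_seq ?addr0 ?chi1 ?mulr1 // => l lr.
by rewrite cr0 ?mul0r //; case/andP: lr.
Qed.


Lemma natr_pchar0_inj (F : fieldType) (charF0 : [pchar F] =i pred0) :
  injective (fun n => n%:R : F).
Proof.
suff le m n : m%:R = n%:R :> F -> (n <= m)%N.
  by move=> m n mn; apply/eqP; rewrite eqn_leq !le.
move=> mn; have [//|le_mn] := orP (leq_total n m).
by rewrite -subn_eq0 -(proj1 (pcharf0P _) charF0) natrB // mn subrr.
Qed.

Section Independence.
Variables (F : fieldType) (charF0 : [pchar F] =i pred0) (alpha : F).
Variables (A : algType F) (tr : trace A) (X : dual_coordinates alpha tr).

Definition tnform (e : nf_index) : tpoly F :=
  nform alpha (in_alg (tpoly F)) (tvar F) (fun w => Tr (tword F w))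
    e.1 e.2.1 e.2.2.

Definition relnform (e : nf_index) : relfree alpha :=
  nform alpha (relC alpha) (relX alpha) (relT alpha) e.1 e.2.1 e.2.2.

Lemma residue_tnform e : residue alpha (tnform e) = relnform e.
Proof. exact: nform_morph. Qed.

Section Values.
Variables (a b : nat -> F).
Let pt i := dual X (a i) (b i).

Let value b s u := nform alpha (in_alg A) pt
  (fun w => (tr (\prod_(i <- w) pt i))%:A) b s u.

Lemma teval_tnform e : teval tr pt (tnform e) = value e.1 e.2.1 e.2.2.
Proof.
apply: nform_morph => [c|i|w w0].
- by rewrite /= tevalZ rmorph1.
- exact: teval_tvar.
exact: teval_Tr_tword.
Qed.

Let dev_pt := dev alpha (in_alg A) pt (fun w => (tr (\prod_(i <- w) pt i))%:A).
Let zeta_pt := zeta alpha (in_alg A) pt (fun w => (tr (\prod_(i <- w) pt i))%:A).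

Lemma re_dev i : re X (dev_pt i) = b i.
Proof. by rewrite /dev_pt /dev big_seq1 (tr_dual X) !dualE; ring. Qed.

Lemma re_zeta i j : re X (zeta_pt i j) = 0.
Proof. by rewrite /zeta_pt /zeta !big_cons !big_nil !(tr_dual X) !dualE; ring. Qed.

Lemma eps_zeta i j : eps X (zeta_pt i j) = - 2%:R * b i * b j.
Proof. by rewrite /zeta_pt /zeta !big_cons !big_nil !(tr_dual X) !dualE; ring. Qed.

Let mono (e : nf_index) :=
  \prod_(i <- e.2.1) a i * \prod_(i <- e.2.2) b i.

Lemma re_prod_pt s : re X (\prod_(i <- s) pt i) = \prod_(i <- s) a i.
Proof. by rewrite (big_morph _ (reM X) (re1 X)); apply: eq_bigr => i _;
  apply: re_dual. Qed.

Lemma re_prod_dev s : re X (\prod_(i <- s) dev_pt i) = \prod_(i <- s) b i.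
Proof. by rewrite (big_morph _ (reM X) (re1 X)); apply: eq_bigr => i _;
  apply: re_dev. Qed.

Lemma re_tnform (e : nf_index) :
  re X (teval tr pt (tnform e)) = if e.1 then 0 else mono e.
Proof.
rewrite teval_tnform /value /nform /mono; case: e => [[] [s u]] /=; last first.
  by rewrite reM re_prod_pt re_prod_dev.
case: u => [|i [|j u]]; rewrite ?re0 //.
by rewrite !reM re_zeta !mul0r.
Qed.

Lemma eps_tnform (e : nf_index) : nf_valid e -> e.1 ->
  eps X (teval tr pt (tnform e)) = - 2%:R * mono e.
Proof.
rewrite teval_tnform /value /nform /mono.
case: e => [[] [s [|i [|j u]]]] //= _ _.
rewrite -mulrA epsM re_zeta eps_zeta mul0r add0r reM.
by rewrite re_prod_pt re_prod_dev !big_cons; ring.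
Qed.

End Values.

(** The value of a monomial at the point that is 2 on the letter i and 1
    elsewhere records the multiplicity of i. *)
Lemma prod_two (w : seq nat) i :
  \prod_(l <- w) (if l == i then 2%:R else 1) = (2 ^ count_mem i w)%:R :> F.
Proof.
elim: w => [|l w IHw]; first by rewrite big_nil.
by rewrite big_cons IHw /= expnD natrM; case: eqP.
Qed.

Lemma sorted_separated (s s' : seq nat) :
    sort leq s = s -> sort leq s' = s' -> s != s' ->
  exists a : nat -> F, \prod_(i <- s) a i != \prod_(i <- s') a i.
Proof.
move=> ss ss' s_s'; have : ~~ perm_eq s s'.
  apply: contraNN s_s' => s_s'; rewrite -ss -ss'; apply/eqP.
  exact/(perm_sortP leq_total leq_trans anti_leq).
rewrite /perm_eq => /allPn[i _ /= cnt];
  exists (fun l => if l == i then 2%:R else 1).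
rewrite !prod_two; apply: contraNN cnt => /eqP/(natr_pchar0_inj charF0)/eqP.
by rewrite eqn_exp2l.
Qed.

(** The first coordinate kills the normal forms of the second kind and turns
    the others into distinct characters; once these are gone, the second
    coordinate does the same for the second kind, up to the factor - 2. *)
Lemma tnform_independent (J : eqType) (r : seq J) (h : J -> nf_index) (c : J -> F) :
    uniq r -> {in r &, injective h} ->
    {in r, forall j, nf_valid (h j)} -> {in r, forall j, nf_canon (h j) = h j} ->
    trace_identity tr (\sum_(j <- r) c j *: tnform (h j)) ->
  {in r, forall j, c j = 0}.
Proof.
move=> r_uniq h_inj h_valid h_can id0.
pose mulV (v w : (nat -> F) * (nat -> F)) :=
  (fun i => v.1 i * w.1 i, fun i => v.2 i * w.2 i).
pose chi j (v : (nat -> F) * (nat -> F)) :=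
  \prod_(i <- (h j).2.1) v.1 i * \prod_(i <- (h j).2.2) v.2 i.
have indep (P : pred J) (c' : J -> F) :
    {in r &, forall i j, P i -> P j -> (h i).1 = (h j).1} ->
    (forall v, \sum_(j <- r | P j) c' j * chi j v = 0) ->
    {in r, forall j, P j -> c' j = 0}.
  move=> sameP c'0 j jr Pj.
  apply: (@characters_independent _ _ mulV (fun=> 1, fun=> 1) _ chi
    [seq j <- r | P j]).
  - by move=> l v w; rewrite /chi /mulV /= !big_split /=; ring.
  - by move=> l; rewrite /chi /= !big1 ?mulr1.
  - move=> l m; rewrite !mem_filter => /andP[Pl lr] /andP[Pm mr] lm.
    have [sl ul] : sort leq (h l).2.1 = (h l).2.1 /\ sort leq (h l).2.2 = (h l).2.2.
      by split; rewrite -[in RHS](h_can l lr).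
    have [sm um] : sort leq (h m).2.1 = (h m).2.1 /\ sort leq (h m).2.2 = (h m).2.2.
      by split; rewrite -[in RHS](h_can m mr).
    have [s_eq|/(sorted_separated sl sm)[v v_sep]] := eqVneq (h l).2.1 (h m).2.1.
      have [u_eq|/(sorted_separated ul um)[v v_sep]] := eqVneq (h l).2.2 (h m).2.2.
        case/eqP: lm; apply: h_inj => //; move: (sameP l m lr mr Pl Pm) s_eq u_eq.
        by case: (h l) (h m) => [bl [sl' ul']] [bm [sm' um']] /= -> -> ->.
      by exists (fun=> 1, v); rewrite /chi /= !(big1_eq _ _) !mul1r.
    by exists (v, fun=> 1); rewrite /chi /= !(big1_eq _ _) !mulr1.
  - exact: filter_uniq.
  - by move=> v; rewrite big_filter.
  - by rewrite mem_filter Pj.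
have value0 v : \sum_(j <- r) c j *:
    teval tr (fun i => dual X (v.1 i) (v.2 i)) (tnform (h j)) = 0.
  rewrite -[RHS](id0 (fun i => dual X (v.1 i) (v.2 i))) [RHS]raddf_sum.
  by apply: eq_bigr => j _; rewrite [RHS]tevalZ.
have c_false : {in r, forall j, ~~ (h j).1 -> c j = 0}.
  apply: indep => [i j _ _ /negPf-> /negPf-> //|v].
  have := congr1 (re X) (value0 v);
    rewrite (big_morph _ (reD X) (re0 X)) re0 => re_sum0.
  rewrite -[RHS]re_sum0 big_mkcond; apply: eq_bigr => j _.
  by rewrite reZ re_tnform; case: (h j).1; rewrite ?mulr0.
have c_true : {in r, forall j, (h j).1 -> - 2%:R * c j = 0}.
  apply: (indep _ (fun j => - 2%:R * c j)) => [i j _ _ -> -> //|v].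
  have := congr1 (eps X) (value0 v);
    rewrite (big_morph _ (epsD X) (eps0 X)) eps0 => eps_sum0.
  rewrite -[RHS]eps_sum0 big_mkcond; apply: eq_big_seq => j jr; rewrite epsZ.
  case: ifP => [hj|/negbT hj]; last by rewrite c_false ?mul0r.
  by rewrite eps_tnform ?h_valid // /chi; ring.
move=> j jr; have [hj|/c_false-> //] := boolP (h j).1.
apply/eqP; move/eqP: (c_true j jr hj); rewrite mulf_eq0 oppr_eq0.
by rewrite (proj1 (pcharf0P _) charF0).
Qed.

End Independence.

(** * Coordinates of C2 *)

Section C2Evaluation.
Variables (F : fieldType) (alpha : F).

Definition diag_entry (M : C2 F) : F := C2_val M 0 0.
Definition nil_entry (M : C2 F) : F := C2_val M 0 1.

Lemma C2_bottom (M : C2 F) : C2_val M 1 0 = 0 /\ C2_val M 1 1 = C2_val M 0 0.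
Proof. by case: M => M /= /andP[/eqP-> /eqP->]. Qed.

Lemma C2_eqP (M N : C2 F) :
  diag_entry M = diag_entry N -> nil_entry M = nil_entry N -> M = N.
Proof.
rewrite /diag_entry /nil_entry => d n; apply: val_inj; apply/matrixP => i j /=.
have [M10 M11] := C2_bottom M; have [N10 N11] := C2_bottom N.
have o2 (l : 'I_2) : l = 0 \/ l = 1.
  by case: l => [[|[|//]] ltl]; [left | right]; apply: val_inj.
by case: (o2 i) => ->; case: (o2 j) => -> //; rewrite ?M10 ?N10 ?M11 ?N11.
Qed.

Lemma C2_valM (M N : C2 F) : C2_val (M * N) = C2_val M *m C2_val N.
Proof. exact: (rmorphM (val : C2 F -> 'M[F]_2)). Qed.

Lemma C2_valB (M N : C2 F) : C2_val (M - N) = C2_val M - C2_val N.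
Proof. exact: (raddfB (val : C2 F -> 'M[F]_2)). Qed.

Lemma C2_valZ c (M : C2 F) : C2_val (c *: M) = c *: C2_val M.
Proof. exact: (linearZ_LR (val : C2 F -> 'M[F]_2)). Qed.

Lemma C2_val1 : C2_val (1 : C2 F) = 1.
Proof. exact: (rmorph1 (val : C2 F -> 'M[F]_2)). Qed.

Lemma diag_entry_is_zmod_morphism : zmod_morphism diag_entry.
Proof. by move=> M N; rewrite /diag_entry C2_valB !mxE. Qed.
Lemma nil_entry_is_zmod_morphism : zmod_morphism nil_entry.
Proof. by move=> M N; rewrite /nil_entry C2_valB !mxE. Qed.
HB.instance Definition _ :=
  GRing.isZmodMorphism.Build (C2 F) F diag_entry diag_entry_is_zmod_morphism.
HB.instance Definition _ :=
  GRing.isZmodMorphism.Build (C2 F) F nil_entry nil_entry_is_zmod_morphism.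

Lemma diag_entry_is_monoid_morphism : monoid_morphism diag_entry.
Proof.
split=> [|M N]; rewrite /diag_entry; first by rewrite C2_val1 mxE.
rewrite C2_valM mxE big_ord_recl big_ord1.
have -> : lift ord0 ord0 = 1 :> 'I_2 by apply: val_inj.
by rewrite (C2_bottom N).1 mulr0 addr0.
Qed.
HB.instance Definition _ :=
  GRing.isMonoidMorphism.Build (C2 F) F diag_entry diag_entry_is_monoid_morphism.

Lemma nil_entryM (M N : C2 F) :
  nil_entry (M * N) = diag_entry M * nil_entry N + nil_entry M * diag_entry N.
Proof.
rewrite /nil_entry C2_valM mxE big_ord_recl big_ord1.
have -> : lift ord0 ord0 = 1 :> 'I_2 by apply: val_inj.
by rewrite (C2_bottom N).2.
Qed.

Lemma diag_entryZ c (M : C2 F) : diag_entry (c *: M) = c * diag_entry M.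
Proof. by rewrite /diag_entry C2_valZ mxE. Qed.

Lemma nil_entryZ c (M : C2 F) : nil_entry (c *: M) = c * nil_entry M.
Proof. by rewrite /nil_entry C2_valZ mxE. Qed.

Lemma C2_mx_subproof (a b : F) :
  (a%:M + b *: delta_mx 0 1 : 'M[F]_2) \in @C2_pred F.
Proof. by rewrite !inE !mxE /= !mulr0 !addr0 mulr1n mulr0n !eqxx. Qed.

Definition C2_mx a b : C2 F := C2Matrix (C2_mx_subproof a b).

Lemma diag_C2_mx a b : diag_entry (C2_mx a b) = a.
Proof. by rewrite /diag_entry !mxE /= mulr0 addr0 mulr1n. Qed.

Lemma nil_C2_mx a b : nil_entry (C2_mx a b) = b.
Proof. by rewrite /nil_entry !mxE /= mulr0n add0r mulr1. Qed.

Lemma C2_coordinates : dual_coordinates alpha (C2_trace alpha 1).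
Proof.
apply: (@DualCoordinates _ _ _ _ diag_entry nil_entry C2_mx).
- exact: raddfD.
- exact: raddfD.
- exact: rmorphM.
- exact: nil_entryM.
- exact: rmorph1.
- exact: diag_entryZ.
- exact: nil_entryZ.
- exact: C2_eqP.
- exact: diag_C2_mx.
- exact: nil_C2_mx.
by move=> M; rewrite /= /C2_trace_fun mul1r.
Qed.

End C2Evaluation.

(** * Reduction of trace polynomials to normal forms *)

Section Spanning.
Variables (F : fieldType) (alpha : F).
Local Notation pi := (residue alpha).
Local Notation span :=
  (nf_span alpha (relC alpha) (relX alpha) (relT alpha)).
Let H4 := @rel_h4 F alpha.
Let H5 := @rel_h5 F alpha.

Lemma residue_span_valid f : span nf_valid (pi f).
Proof.
have ok_valid m q : span (nf_content m) q -> span nf_valid q.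
  by apply: nf_spanW => e /andP[].
have validX w : span nf_valid (pi (tword F w)).
  rewrite residue_tword; apply: (ok_valid w); exact: nf_span_letters.
elim/tpoly_ind: f => [p|i|f g IHf IHg|f g IHf IHg].
- elim/ptrace_ind: p => [c|c|p q IHp IHq|p q IHp IHq].
  + have -> : pi (pt_emb (mon_algC _ c)) = relC alpha c * pi (tword F [::]).
      by rewrite -residueZ tscaleE /tword big_nil mulr1.
    exact: nf_spanZ.
  + rewrite tr_word_repr -ptr_tword; apply: (ok_valid (val (repr c))).
    exact: (nf_span_trace H4 H5 (valP (repr c))).
  + by rewrite !raddfD /=; apply: nf_spanD.
  + by rewrite !rmorphM /=; apply: (nf_span_validM H4 H5).
- by rewrite -tword1.
- by rewrite raddfD; apply: nf_spanD.
- by rewrite rmorphM; apply: (nf_span_validM H4 H5).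
Qed.

(** A trace monomial is a product of traces and letters, and the spans of
    normal forms multiply with the concatenation of contents. *)
Lemma residue_span_multilinear n f :
  MT n f -> span (nf_content (iota 0 n)) (pi f).
Proof.
case=> l [l_ok ->]; elim: l l_ok => [_|[c [ts w]] l IHl] /=.
  by rewrite big_nil raddf0; apply: nf_span0.
case/andP=> /andP[/= ts0 ts_perm] /IHl span_l.
rewrite big_cons raddfD /= residueZ rmorphM /=; apply: nf_spanD => //.
apply/nf_spanZ/(nf_span_perm ts_perm)/(nf_spanM H4 H5); last first.
  by rewrite residue_tword; apply: nf_span_letters.
elim: ts ts0 {ts_perm} => [_|v ts IHts] /=.
  have -> : pi (\prod_(v <- [::]) Tr (tword F v)) = \prod_(i <- [::]) relX alpha i.
    by rewrite !big_nil rmorph1.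
  exact: nf_span_letters.
case/andP=> v0 /IHts span_ts; rewrite big_cons rmorphM.
exact: (nf_spanM H4 H5 (nf_span_trace H4 H5 v0)).
Qed.

Lemma nf_content_canon m e : nf_content m e -> nf_content m (nf_canon e).
Proof.
rewrite /nf_content /nf_valid /nf_canon /= size_sort => /andP[-> /=].
by apply: perm_trans; apply: perm_cat; rewrite perm_sort.
Qed.

Lemma residue_canon (P : pred nf_index) f :
    (forall e, P e -> P (nf_canon e)) -> span P (pi f) ->
  exists (r : seq nf_index) (c : nf_index -> F),
    [/\ uniq r, all P r, all (fun e => nf_canon e == e) r
      & Ttr_generated (gens alpha) (f - \sum_(e <- r) c e *: tnform alpha e)].
Proof.
move=> Pcanon /(nf_span_canon (@relTC F alpha) H4 Pcanon)
  [r [c [r_uniq rP r_can fE]]].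
exists r, c; split=> //; apply/residue_eq; rewrite fE raddf_sum.
by apply: eq_bigr => e _; rewrite /= residueZ residue_tnform.
Qed.

End Spanning.

(** * Multilinear normal forms *)

Section MultilinearForms.
Variable F : fieldType.

(** The F-span of the trace monomials of content m, so that MT n is the case of
    the content 0, ..., n - 1. Other contents are needed because a normal form
    is a product. *)
Inductive mt_span (m : seq nat) : tpoly F -> Prop :=
| mt_span0 : mt_span m 0
| mt_spanS c ts w f :
    all (fun v => v != [::]) ts -> perm_eq (flatten ts ++ w) m ->
    mt_span m f ->
    mt_span m (c *: ((\prod_(v <- ts) Tr (tword F v)) * tword F w) + f).

Lemma mt_span_MT n f : mt_span (iota 0 n) f -> MT n f.
Proof.
elim=> [|c ts w g ts0 ts_perm _ [l [l_ok ->]]].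
  by exists [::]; rewrite big_nil.
by exists ((c, (ts, w)) :: l);
  rewrite /= /multilinear_monomial ts0 ts_perm big_cons.
Qed.

Lemma mt_spanD m f g : mt_span m f -> mt_span m g -> mt_span m (f + g).
Proof.
elim=> [|c ts w h ts0 ts_perm _ IHh] mg; first by rewrite add0r.
by rewrite -addrA; apply: mt_spanS => //; apply: IHh.
Qed.

Lemma mt_spanZ m c f : mt_span m f -> mt_span m (c *: f).
Proof.
elim=> [|d ts w h ts0 ts_perm _ IHh]; first by rewrite scaler0; apply: mt_span0.
by rewrite scalerDr scalerA; apply: mt_spanS.
Qed.

Lemma mt_spanB m f g : mt_span m f -> mt_span m g -> mt_span m (f - g).
Proof. by move=> mf mg; rewrite -scaleN1r; apply/mt_spanD/mt_spanZ. Qed.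

Lemma mt_span_perm m m' f : perm_eq m m' -> mt_span m f -> mt_span m' f.
Proof.
move=> mm'; elim=> [|c ts w g ts0 ts_perm _]; first exact: mt_span0.
by apply: mt_spanS => //; apply: perm_trans mm'.
Qed.

Lemma mt_span_mono ts w : all (fun v => v != [::]) ts ->
  mt_span (flatten ts ++ w) ((\prod_(v <- ts) Tr (tword F v)) * tword F w).
Proof.
move=> ts0; rewrite -[_ * _]scale1r -[_ *: _]addr0.
by apply: mt_spanS => //; apply: mt_span0.
Qed.

Lemma mt_span_word w : mt_span w (tword F w).
Proof. by have := @mt_span_mono [::] w isT; rewrite big_nil mul1r. Qed.

Lemma mt_span_Tr w : w != [::] -> mt_span w (Tr (tword F w)).
Proof.
move=> w0; have := @mt_span_mono [:: w] [::]; rewrite /= w0 !cats0 big_seq1.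
by rewrite /tword big_nil mulr1; apply.
Qed.

Lemma prod_Tr_central (ts : seq (seq nat)) f :
  \prod_(v <- ts) Tr (tword F v) * f = f * \prod_(v <- ts) Tr (tword F v).
Proof.
elim: ts => [|v ts IHts]; first by rewrite big_nil mul1r mulr1.
by rewrite big_cons -mulrA IHts mulrA Tr_central mulrA.
Qed.

Lemma mt_spanM m m' f g :
  mt_span m f -> mt_span m' g -> mt_span (m ++ m') (f * g).
Proof.
elim=> [|c ts w h ts0 ts_perm _ IHh] mg; first by rewrite mul0r; apply: mt_span0.
rewrite mulrDl; apply: mt_spanD; last exact: IHh.
rewrite -scalerAl; apply: mt_spanZ.
elim: mg => [|c' ts' w' h' ts0' ts_perm' _ IHh']; first by rewrite mulr0;
  apply: mt_span0.
rewrite mulrDr; apply: mt_spanD => //; rewrite -scalerAr; apply: mt_spanZ.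
rewrite mulrA -(mulrA _ (tword F w)) -prod_Tr_central mulrA
  -big_cat -mulrA -tword_cat.
apply: mt_span_perm (mt_span_mono (ts := ts ++ ts') (w ++ w') _).
  apply/permP => y; move/permP: ts_perm => ts_perm;
    move/permP: ts_perm' => ts_perm'.
  by rewrite flatten_cat !count_cat -ts_perm -ts_perm' !count_cat addnACA.
by rewrite all_cat ts0.
Qed.

Lemma mt_span_tnform alpha m e : nf_content m e -> mt_span m (tnform alpha e).
Proof.
case: e => [b [s u]] /andP[e2 /=]; have var i : mt_span [:: i] (tvar F i).
  by rewrite -tword1; apply: mt_span_word.
have dev_mt i : mt_span [:: i]
  (dev alpha (in_alg _) (tvar F) (fun w => Tr (tword F w)) i).
  apply: mt_spanB; first exact: mt_span_Tr.
  by rewrite /= mulr_algl; apply: mt_spanZ.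
have prod_mt (f : nat -> tpoly F) w : (forall i, mt_span [:: i] (f i)) ->
    mt_span w (\prod_(i <- w) f i).
  move=> mf; elim: w => [|i w IHw].
    by have := mt_span_word [::]; rewrite /tword !big_nil.
  by rewrite big_cons; apply: (mt_spanM (mf i) IHw).
have X := prod_mt _ s var; move=> su_m; apply: mt_span_perm su_m _.
rewrite /tnform /nform /=; case: b e2 => /= [|_]; last exact/mt_spanM/prod_mt.
case: u => [|i [|j u]] // _.
have su : perm_eq (([:: i; j] ++ s) ++ u) (s ++ [:: i, j & u]).
  by rewrite -catA (perm_catCA [:: i; j] s u).
apply: mt_span_perm su _; apply/mt_spanM/prod_mt => //; apply: mt_spanM X.
have ji : perm_eq [:: j; i] [:: i; j] by rewrite (perm_catC [:: j] [:: i]).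
apply: mt_spanD; last first.
  by rewrite /= mulr_algl -tword2; apply/mt_spanZ/mt_span_word.
apply: mt_spanB; first (apply: mt_spanB; first exact: mt_span_Tr).
  exact: (mt_spanM (mt_span_Tr (w := [:: i]) isT) (var j)).
exact: (mt_span_perm ji (mt_spanM (mt_span_Tr (w := [:: j]) isT) (var i))).
Qed.

End MultilinearForms.

Section MultilinearIndices.
Variable n : nat.

Definition set_word (A : {set 'I_n}) : seq nat := [seq val i | i <- enum A].

(** The set records the letters that are under dev or in zeta; the others are
    outside the traces. *)
Definition ml_index (e : bool * {set 'I_n}) : nf_index :=
  (e.1, (set_word (~: e.2), set_word e.2)).

Definition ml_pred : pred (bool * {set 'I_n}) :=
  fun e => e.1 ==> (1 < #|e.2|)%N.

Definition ml_indices : seq nf_index := [seq ml_index e | e <- enum ml_pred].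

Lemma mem_set_word A (i : 'I_n) : (val i \in set_word A) = (i \in A).
Proof. by rewrite mem_map ?mem_enum //; apply: val_inj. Qed.

Lemma set_word_inj : injective set_word.
Proof. by move=> A B AB; apply/setP => i; rewrite -!mem_set_word AB. Qed.

Lemma size_set_word A : size (set_word A) = #|A|.
Proof. by rewrite size_map cardE. Qed.

Lemma sort_set_word A : sort leq (set_word A) = set_word A.
Proof.
apply: (sorted_sort leq_trans); apply: (subseq_sorted leq_trans) (iota_sorted 0 n).
rewrite -val_enum_ord; apply: map_subseq; rewrite enumT; exact: filter_subseq.
Qed.

Lemma uniq_set_word A : uniq (set_word A).
Proof. by rewrite map_inj_uniq ?enum_uniq //; apply: val_inj. Qed.

Lemma set_word_perm A : perm_eq (set_word (~: A) ++ set_word A) (iota 0 n).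
Proof.
apply: uniq_perm; first 1 last.
- exact: iota_uniq.
- move=> i; rewrite mem_cat mem_iota /= add0n; have [lt_in|le_ni] := ltnP i n.
    by rewrite !(mem_set_word _ (Ordinal lt_in)) inE orNb.
  apply/negP => /orP[] /mapP[j _ ij]; by have := ltn_ord j;
    rewrite -ij ltnNge le_ni.
rewrite cat_uniq !uniq_set_word andbT /=; apply/hasPn => _ /mapP[i iA ->].
by rewrite mem_set_word inE -mem_enum iA.
Qed.

Lemma ml_indices_uniq : uniq ml_indices.
Proof.
rewrite map_inj_uniq ?enum_uniq // => [[b A] [b' A']] [-> _ AA'].
by rewrite (set_word_inj AA').
Qed.

Lemma ml_indices_content : all (nf_content (iota 0 n)) ml_indices.
Proof.
apply/allP => e /mapP[[b A] /=]; rewrite mem_enum => bA ->.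
by rewrite /nf_content /nf_valid /= size_set_word [_ ==> _]bA set_word_perm.
Qed.

Lemma ml_indices_canon : all (fun e => nf_canon e == e) ml_indices.
Proof.
by apply/allP => _ /mapP[e _ ->]; rewrite /nf_canon /= !sort_set_word.
Qed.

Lemma ml_indicesP e :
  nf_content (iota 0 n) e -> nf_canon e = e -> e \in ml_indices.
Proof.
case: e => [b [s u]] /andP[/= su2 su_perm] [s_sort u_sort].
pose A := [set i : 'I_n | val i \in u].
have mem_su i : (i \in s) || (i \in u) = (i < n)%N.
  by rewrite -mem_cat (perm_mem su_perm) mem_iota.
have : uniq (s ++ u) by rewrite (perm_uniq su_perm) iota_uniq.
rewrite cat_uniq => /and3P[s_uniq /hasPn su u_uniq].
have uE : set_word A = u.
  rewrite -sort_set_word -u_sort; apply/(perm_sortP leq_total leq_trans anti_leq).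
  apply: uniq_perm; rewrite ?uniq_set_word // => i.
  have [lt_in|le_ni] := ltnP i n.
    by rewrite (mem_set_word _ (Ordinal lt_in)) inE.
  have /norP[_ /negPf->] : ~~ ((i \in s) || (i \in u)) by rewrite mem_su -leqNgt.
  by apply/negP => /mapP[j _ ij]; have := ltn_ord j; rewrite -ij ltnNge le_ni.
have sE : set_word (~: A) = s.
  rewrite -sort_set_word -s_sort; apply/(perm_sortP leq_total leq_trans anti_leq).
  apply: uniq_perm; rewrite ?uniq_set_word // => i.
  have [lt_in|le_ni] := ltnP i n.
    rewrite (mem_set_word _ (Ordinal lt_in)) !inE /=.
    have := mem_su i; rewrite lt_in; have := su i; rewrite /=.
    by case: (i \in u) => [/(_ isT)/negPf->|_] //=; rewrite orbF => ->.
  have /norP[/negPf-> _] : ~~ ((i \in s) || (i \in u)) by rewrite mem_su -leqNgt.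
  by apply/negP => /mapP[j _ ij]; have := ltn_ord j; rewrite -ij ltnNge le_ni.
apply/mapP; exists (b, A); last by rewrite /ml_index /= uE sE.
by rewrite mem_enum; move: su2; rewrite /nf_valid -uE size_set_word.
Qed.

(** Every subset gives a normal form of the first kind, and all but the n + 1
    subsets of at most one element give one of the second kind. *)
Lemma size_ml_indices : size ml_indices = (2 ^ n.+1 - n - 1)%N.
Proof.
rewrite size_map -cardE.
have card_k k : (\sum_(A : {set 'I_n}) (#|A| == k) = 'C(n, k))%N.
  rewrite -[n in RHS]card_ord -card_draws -sum1_card [RHS]big_mkcond /=.
  by apply: eq_bigr => A _; rewrite inE; case: eqP.
have card_all : (\sum_(A : {set 'I_n}) 1 = 2 ^ n)%N.
  by rewrite sum_nat_const muln1 -cardsT -powersetT card_powerset cardsT card_ord.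
have -> : #|ml_pred| =
  (\sum_(A : {set 'I_n}) 1 + \sum_(A : {set 'I_n}) (1 < #|A|))%N.
  rewrite -sum1_card big_mkcond /=
    -(pair_big xpredT xpredT (fun b A => ml_pred (b, A) : nat)) /=.
  by rewrite big_bool addnC.
have split2 : (2 ^ n = \sum_(A : {set 'I_n}) (1 < #|A|) + n + 1)%N.
  rewrite -card_all -[X in (_ + X + _)%N](bin1 n) -[X in (_ + _ + X)%N](bin0 n).
  rewrite -!card_k -!big_split /=.
  by apply: eq_bigr => A _; case: #|A| => [|[|k]].
by rewrite card_all expnS mul2n -addnn -subnDA [X in (_ + X - _)%N]split2
  -(addnA _ n) (addnA (2 ^ n)%N) addnK.
Qed.

End MultilinearIndices.

(** * Identities and codimensions of C2 *)

Section MainResults.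
Variables (F : fieldType) (charF0 : [pchar F] =i pred0) (alpha : F).
Local Notation tr := (C2_trace alpha 1).
Let X := C2_coordinates alpha.

(** Identities form an ideal that contains the generated one. *)
Lemma identity_congr f g :
  Ttr_generated (gens alpha) (f - g) -> trace_identity tr f -> trace_identity tr g.
Proof.
move=> /(generated_identity X) fg f0 a.
by have := fg a; rewrite raddfB /= f0 sub0r => /eqP; rewrite oppr_eq0 => /eqP.
Qed.

Lemma identity_generated f :
  trace_identity tr f -> Ttr_generated (gens alpha) f.
Proof.
have valid_canon e : nf_valid e -> nf_valid (nf_canon e).
  by rewrite /nf_valid /nf_canon /= size_sort.
have [r [c [r_uniq /allP r_valid /allP r_can If]]] :=
  residue_canon valid_canon (residue_span_valid alpha f).
move=> /(identity_congr If) id_r.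
have c0 : {in r, forall e, c e = 0}.
  apply: (tnform_independent charF0 X (h := id)) id_r => //.
  by move=> e /r_can/eqP.
move: If; rewrite big1_seq ?subr0 // => e /andP[_ er].
by rewrite c0 ?scale0r.
Qed.

Lemma C2_codim n : trace_codim tr n (2 ^ n.+1 - n - 1)%N.
Proof.
rewrite -size_ml_indices; set L := ml_indices n.
pose h := tnth (in_tuple L); exists (fun i => tnform alpha (h i)).
have hL i : h i \in L by apply: mem_tnth.
have h_ok i : nf_content (iota 0 n) (h i) := allP (ml_indices_content n) _ (hL i).
split=> [i|f MTf|c id_c i].
- exact/mt_span_MT/mt_span_tnform.
- have [r [c [r_uniq /allP r_ok /allP r_can If]]] :=
    residue_canon (nf_content_canon (m
      := iota 0 n)) (residue_span_multilinear alpha MTf).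
  have rL : {subset r <= L}.
    by move=> e er; apply: ml_indicesP; [apply: r_ok | apply/eqP/r_can].
  exists (fun i => if h i \in r then c (h i) else 0).
  apply/(generated_identity X).
  suff <- : \sum_(e <- r) c e *: tnform alpha e
      = \sum_i (if h i \in r then c (h i) else 0) *: tnform alpha (h i) by [].
  rewrite -(big_tuple _ _ (in_tuple L) xpredT
    (fun e => (if e \in r then c e else 0) *: tnform alpha e)) /=.
  have rE : perm_eq r [seq e <- L | e \in r].
    apply: uniq_perm; rewrite ?filter_uniq ?ml_indices_uniq // => e.
    by rewrite mem_filter; case er: (e \in r); rewrite // rL.
  rewrite (perm_big _ rE) big_filter big_mkcond; apply: eq_bigr => e _.
  by case: ifP; rewrite ?scale0r.
apply: (tnform_independent charF0 X (r := index_enum 'I_(size L)) (h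
  := h)) id_c _ _ => //.
- exact: index_enum_uniq.
- have h_inj : injective h by apply/tuple_uniqP; apply: ml_indices_uniq.
  by move=> j l _ _; apply: h_inj.
- by move=> j _; case/andP: (h_ok j).
- by move=> j _; apply/eqP; apply: (allP (ml_indices_canon n)).
Qed.

End MainResults.

Theorem theorem21 (F : fieldType) (charF0 : [pchar F] =i pred0) (alpha : F) :
  (forall f : tpoly F,
     trace_identity (C2_trace alpha 1) f <->
     Ttr_generated
       (fun g : tpoly F => [\/ g = f1 F, g = h4 alpha | g = h5 alpha]) f) /\
  (forall n : nat, (1 <= n)%N ->
     trace_codim (C2_trace alpha 1) n (2 ^ n.+1 - n - 1)%N).
Proof.
split=> [f|n _]; last exact: C2_codim.
split; first exact: identity_generated.
exact: (generated_identity (C2_coordinates alpha)).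
Qed.
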